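(* Over BISH, the principles $\mathbf{POS}_p^{[0,1]}$ and $\mathbf{AS}_L^{[0,1]}$ are equivalent.
   Context: The setting is Bishop-style constructive mathematics (BISH): intuitionistic logic together with dependent choice; neither the law of excluded middle, nor LPO, nor Markov's principle may be used. ''Equivalent over BISH'' means that each principle can be derived from the other in BISH. $\mathbf{POS}_p^X$ (pointwise positivity property), for a metric space $X$: if $f:X\to\mathbf{R}$ is a pointwise continuous, positive-valued mapping ($f(x)>0$ for each $x\in X$), and if $\inf_X f$ exists, then $\inf_X f>0$. Here ''$m=\inf_X f$ exists'' means that there is a real number $m$ with $m\le f(x)$ for all $x\in X$ such that for each $\varepsilon>0$ there exists $x\in X$ with $f(x)<m+\varepsilon$. If $X$ is a subspace of a metric space $(E,\rho)$ and $\omega\in E$ satisfies $\rho(\omega,X)>0$ (that is, there exists $\delta>0$ with $\rho(\omega,y)\geqslant\delta$ for all $y\in X$), then the metric space $X\cup\{\omega\}$ is called a one-point extension of $X$. A sequence $(x_n)_{n\geqslant1}$ in $E$ is eventually bounded away from the point $x\in E$ if there exist $N$ and $\delta>0$ such that $\rho(x,x_n)\geqslant\delta$ for all $n\geqslant N$. $\mathbf{AS}_L^X$ (limited anti-Specker property): if $X\cup\{\omega\}$ is a one-point extension of $X$, and $(x_n)_{n\geqslant1}$ is a sequence in $X\cup\{\omega\}$ that is eventually bounded away from each point of $X$, then there exists $n$ such that $x_n=\omega$. (This property does not depend on the choice of one-point extension of $X$.) *)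

(* Defs.v *)
From Stdlib Require Import List.
Import ListNotations.

(** Rocq with the usual classical axioms proves both principles outright, so the
    claim "P and Q are equivalent over BISH" is stated here as what it means:
    each is _derivable_ from the other in a formal system for Bishop's
    mathematics.  The system is many-sorted intuitionistic first-order logic with
    equality.  The sorts are the sets of Bishop's mathematics that are needed
    (with products and function sets), and the non-logical axioms are
    induction, function extensionality, the existence of the function determined
    by a total single-valued relation, dependent choice, and Bridges' axioms for
    the constructive real line (completeness being that of Cauchy sequences, and the
    maximum of two numbers, which BISH constructs, being primitive).  All of them
    are accepted in BISH.  Neither excluded middle, nor LPO, nor Markov's
    principle is among the rules or axioms. *)

(** [Base k] is a set about which nothing is assumed. *)
Inductive sort : Type :=
| Nat
| Real
| Interval                              (* the interval [0,1] *)
| Base (k : nat)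
| Prod (a b : sort)
| Fun (a b : sort).

Definition ctx : Type := list sort.

Inductive var : ctx -> sort -> Type :=
| vz (G : ctx) (s : sort) : var (s :: G) s
| vs (G : ctx) (s r : sort) : var G s -> var (r :: G) s.
Arguments vz {G s}.
Arguments vs {G s r} _.

Inductive cst : sort -> Type :=
| c_zero : cst Nat
| c_succ : cst (Fun Nat Nat)
| c_pair (a b : sort) : cst (Fun a (Fun b (Prod a b)))
| c_fst (a b : sort) : cst (Fun (Prod a b) a)
| c_snd (a b : sort) : cst (Fun (Prod a b) b)
| c_rzero : cst Real
| c_rone : cst Real
| c_radd : cst (Fun Real (Fun Real Real))
| c_ropp : cst (Fun Real Real)
| c_rmul : cst (Fun Real (Fun Real Real))
| c_rmax : cst (Fun Real (Fun Real Real))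
| c_ofnat : cst (Fun Nat Real)          (* the embedding of N into R *)
| c_incl : cst (Fun Interval Real).     (* the inclusion of [0,1] into R *)

Inductive tm (G : ctx) : sort -> Type :=
| Var (s : sort) : var G s -> tm G s
| Cst (s : sort) : cst s -> tm G s
| App (a b : sort) : tm G (Fun a b) -> tm G a -> tm G b.
Arguments Var {G s} _.
Arguments Cst {G s} _.
Arguments App {G a b} _ _.

Inductive fm (G : ctx) : Type :=
| Bot : fm G
| Eq (s : sort) (t u : tm G s) : fm G
| Lt (t u : tm G Real) : fm G
| And (p q : fm G) : fm G
| Or (p q : fm G) : fm G
| Imp (p q : fm G) : fm G
| All (s : sort) (p : fm (s :: G)) : fm G
| Ex (s : sort) (p : fm (s :: G)) : fm G.
Arguments Bot {G}.
Arguments Eq {G s} t u.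
Arguments Lt {G} t u.
Arguments And {G} p q.
Arguments Or {G} p q.
Arguments Imp {G} p q.
Arguments All {G} s & p.
Arguments Ex {G} s & p.

Definition sentence : Type := fm [].

Definition renaming (G D : ctx) : Type := forall s, var G s -> var D s.
Definition substitution (G D : ctx) : Type := forall s, var G s -> tm D s.

Definition rcons {G D : ctx} {r : sort} (x : var D r) (f : renaming G D) :
    renaming (r :: G) D :=
  fun s v =>
    match v in var G' s'
      return match G' with
             | [] => unit
             | r0 :: G0 => var D r0 -> renaming G0 D -> var D s'
             end
    with
    | vz => fun x _ => x
    | vs w => fun _ f => f _ w
    end x f.

Definition scons {G D : ctx} {r : sort} (t : tm D r) (f : substitution G D) :
    substitution (r :: G) D :=
  fun s v =>
    match v in var G' s'
      return match G' with
             | [] => unit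
             | r0 :: G0 => tm D r0 -> substitution G0 D -> tm D s'
             end
    with
    | vz => fun t _ => t
    | vs w => fun _ f => f _ w
    end t f.

Fixpoint tm_ren {G D : ctx} (f : renaming G D) {s : sort} (t : tm G s) : tm D s :=
  match t with
  | Var v => Var (f _ v)
  | Cst c => Cst c
  | App t u => App (tm_ren f t) (tm_ren f u)
  end.

Fixpoint tm_sub {G D : ctx} (f : substitution G D) {s : sort} (t : tm G s) : tm D s :=
  match t with
  | Var v => f _ v
  | Cst c => Cst c
  | App t u => App (tm_sub f t) (tm_sub f u)
  end.

Definition rup {G D : ctx} {r : sort} (f : renaming G D) : renaming (r :: G) (r :: D) :=
  rcons vz (fun s v => vs (f s v)).

Definition sup {G D : ctx} {r : sort} (f : substitution G D) :
    substitution (r :: G) (r :: D) :=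
  scons (Var vz) (fun s v => tm_ren (fun _ => vs) (f s v)).

Fixpoint fm_ren {G D : ctx} (f : renaming G D) (p : fm G) : fm D :=
  match p with
  | Bot => Bot
  | Eq t u => Eq (tm_ren f t) (tm_ren f u)
  | Lt t u => Lt (tm_ren f t) (tm_ren f u)
  | And p q => And (fm_ren f p) (fm_ren f q)
  | Or p q => Or (fm_ren f p) (fm_ren f q)
  | Imp p q => Imp (fm_ren f p) (fm_ren f q)
  | All s p => All s (fm_ren (rup f) p)
  | Ex s p => Ex s (fm_ren (rup f) p)
  end.

Fixpoint fm_sub {G D : ctx} (f : substitution G D) (p : fm G) : fm D :=
  match p with
  | Bot => Bot
  | Eq t u => Eq (tm_sub f t) (tm_sub f u)
  | Lt t u => Lt (tm_sub f t) (tm_sub f u)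
  | And p q => And (fm_sub f p) (fm_sub f q)
  | Or p q => Or (fm_sub f p) (fm_sub f q)
  | Imp p q => Imp (fm_sub f p) (fm_sub f q)
  | All s p => All s (fm_sub (sup f) p)
  | Ex s p => Ex s (fm_sub (sup f) p)
  end.

Definition wk {G : ctx} {r : sort} (p : fm G) : fm (r :: G) := fm_ren (fun _ => vs) p.

(** [ext G D]: [D] is [G] extended by further variables.  Instances of this class
    let a term be used, as [#t], under binders that do not occur in its context;
    the quantifier notations below bind a Rocq name to a de Bruijn variable. *)
Class ext (G D : ctx) : Type := emb : renaming G D.
#[global] Instance ext_refl (G : ctx) : ext G G := fun _ v => v.
#[global] Instance ext_cons (G D : ctx) (r : sort) (e : ext G D) : ext G (r :: D) :=
  fun s v => vs (e s v).

Definition lift {G D : ctx} {e : ext G D} {s : sort} (t : tm G s) : tm D s :=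
  tm_ren (@emb G D e) t.

(** Instances of formulas: [p] has one, respectively two, distinguished variables,
    the second one of [sub2] being the innermost. *)
Definition sub1 {G D : ctx} {e : ext G D} {a : sort} (p : fm (a :: G)) (t : tm D a) :
    fm D :=
  fm_sub (scons t (fun s v => Var (emb s v))) p.

Definition sub2 {G D : ctx} {e : ext G D} {a b : sort} (p : fm (b :: a :: G))
    (t : tm D a) (u : tm D b) : fm D :=
  fm_sub (scons u (scons t (fun s v => Var (emb s v)))) p.

Definition all_hoas {G : ctx} (s : sort) (f : tm (s :: G) s -> fm (s :: G)) : fm G :=
  All s (f (Var vz)).
Definition ex_hoas {G : ctx} (s : sort) (f : tm (s :: G) s -> fm (s :: G)) : fm G :=
  Ex s (f (Var vz)).
Arguments all_hoas {G} s & f.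
Arguments ex_hoas {G} s & f.

Declare Scope bish_scope.
Delimit Scope bish_scope with B.

Notation "# t" := (lift t) (at level 1, format "# t") : bish_scope.
Notation "f @ t" := (App f t) (at level 11, left associativity) : bish_scope.
Notation "⊥" := Bot (at level 0) : bish_scope.
Notation "t = u" := (Eq t u) : bish_scope.
Notation "t < u" := (Lt t u) : bish_scope.
Notation "p ∧ q" := (And p q) (at level 80, right associativity) : bish_scope.
Notation "p ∨ q" := (Or p q) (at level 85, right associativity) : bish_scope.
Notation "p → q" := (Imp p q)
  (at level 99, q at level 200, right associativity) : bish_scope.
Notation "¬ p" := (Imp p Bot) (at level 75, right associativity) : bish_scope.
Notation "∀ x : s , p" := (all_hoas s (fun x => p%B))
  (at level 200, x name, s at level 99, p at level 200, right associativity) : bish_scope.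
Notation "∃ x : s , p" := (ex_hoas s (fun x => p%B))
  (at level 200, x name, s at level 99, p at level 200, right associativity) : bish_scope.

Local Open Scope bish_scope.

Definition zero {G : ctx} : tm G Nat := Cst c_zero.
Definition succ {G : ctx} (t : tm G Nat) : tm G Nat := Cst c_succ @ t.
Definition tpair {G : ctx} {a b : sort} (t : tm G a) (u : tm G b) : tm G (Prod a b) :=
  Cst (c_pair a b) @ t @ u.
Definition tfst {G : ctx} {a b : sort} (t : tm G (Prod a b)) : tm G a := Cst (c_fst a b) @ t.
Definition tsnd {G : ctx} {a b : sort} (t : tm G (Prod a b)) : tm G b := Cst (c_snd a b) @ t.
Definition rzero {G : ctx} : tm G Real := Cst c_rzero.
Definition rone {G : ctx} : tm G Real := Cst c_rone.
Definition radd {G : ctx} (t u : tm G Real) : tm G Real := Cst c_radd @ t @ u.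
Definition ropp {G : ctx} (t : tm G Real) : tm G Real := Cst c_ropp @ t.
Definition rmul {G : ctx} (t u : tm G Real) : tm G Real := Cst c_rmul @ t @ u.
Definition rmax {G : ctx} (t u : tm G Real) : tm G Real := Cst c_rmax @ t @ u.
Definition ofnat {G : ctx} (t : tm G Nat) : tm G Real := Cst c_ofnat @ t.
Definition incl {G : ctx} (t : tm G Interval) : tm G Real := Cst c_incl @ t.

Notation "0" := rzero : bish_scope.
Notation "1" := rone : bish_scope.
Notation "t + u" := (radd t u) : bish_scope.
Notation "- t" := (ropp t) : bish_scope.
Notation "t - u" := (radd t (ropp u)) : bish_scope.
Notation "t * u" := (rmul t u) : bish_scope.
Notation "t <= u" := (Imp (Lt u t) Bot) : bish_scope.

Definition rabs {G : ctx} (t : tm G Real) : tm G Real := rmax t (- t).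

(** The order of the natural numbers, through their embedding into the reals. *)
Definition nat_le {G : ctx} (t u : tm G Nat) : fm G := ofnat t <= ofnat u.
Notation "t ≼ u" := (nat_le t u) (at level 70) : bish_scope.

Definition ex_unique {G : ctx} {a b : sort} (p : fm (b :: a :: G)) : fm (a :: G) :=
  Ex b (p ∧ ∀ z : b, fm_sub (scons #z (fun s v => Var (vs (vs v)))) p → #z = Var (vs vz)).

Definition cauchy {G : ctx} (x : tm G (Fun Nat Real)) : fm G :=
  ∀ e : Real, 0 < #e →
    ∃ N : Nat, ∀ m : Nat, ∀ n : Nat, #N ≼ #m → #N ≼ #n →
      rabs (#x @ #m - #x @ #n) < #e.

Definition converges {G : ctx} (x : tm G (Fun Nat Real)) (l : tm G Real) : fm G :=
  ∀ e : Real, 0 < #e → ∃ N : Nat, ∀ n : Nat, #N ≼ #n → rabs (#x @ #n - #l) < #e.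

Inductive axiom (G : ctx) : fm G -> Prop :=
| ax_succ_zero (t : tm G Nat) : axiom G (¬ (succ t = zero))
| ax_succ_inj (t u : tm G Nat) : axiom G (succ t = succ u → t = u)
| ax_induction (p : fm (Nat :: G)) :
    axiom G (sub1 p zero →
             (∀ n : Nat, sub1 p #n → sub1 p (succ #n)) →
             ∀ n : Nat, sub1 p #n)
| ax_fst (a b : sort) (t : tm G a) (u : tm G b) : axiom G (tfst (tpair t u) = t)
| ax_snd (a b : sort) (t : tm G a) (u : tm G b) : axiom G (tsnd (tpair t u) = u)
| ax_pair (a b : sort) (t : tm G (Prod a b)) : axiom G (tpair (tfst t) (tsnd t) = t)
| ax_fun_ext (a b : sort) (f g : tm G (Fun a b)) :
    axiom G ((∀ x : a, #f @ #x = #g @ #x) → f = g)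
| ax_fun_ex (a b : sort) (p : fm (b :: a :: G)) :
    axiom G (All a (ex_unique p) →
             ∃ f : Fun a b, ∀ x : a, sub2 p #x (#f @ #x))
(* dependent choice on the subset of [a] defined by [p] *)
| ax_dependent_choice (a : sort) (p : fm (a :: G)) (q : fm (a :: a :: G)) :
    axiom G ((∀ x : a, sub1 p #x → ∃ y : a, sub1 p #y ∧ sub2 q #x #y) →
             ∀ x : a, sub1 p #x →
               ∃ f : Fun Nat a, #f @ zero = #x ∧
                 ∀ n : Nat, sub1 p (#f @ #n) ∧ sub2 q (#f @ #n) (#f @ succ #n))
| ax_radd_comm (x y : tm G Real) : axiom G (x + y = y + x)
| ax_radd_assoc (x y z : tm G Real) : axiom G (x + (y + z) = (x + y) + z)
| ax_radd_zero (x : tm G Real) : axiom G (x + 0 = x)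
| ax_radd_opp (x : tm G Real) : axiom G (x - x = 0)
| ax_rmul_comm (x y : tm G Real) : axiom G (x * y = y * x)
| ax_rmul_assoc (x y z : tm G Real) : axiom G (x * (y * z) = (x * y) * z)
| ax_rmul_one (x : tm G Real) : axiom G (x * 1 = x)
| ax_rmul_radd (x y z : tm G Real) : axiom G (x * (y + z) = x * y + x * z)
| ax_rinv (x : tm G Real) : axiom G (x < 0 ∨ 0 < x → ∃ y : Real, #x * #y = 1)
| ax_rlt_zero_one : axiom G (0 < 1)
| ax_rlt_asym (x y : tm G Real) : axiom G (x < y → y < x → ⊥)
| ax_rlt_cotrans (x y z : tm G Real) : axiom G (x < y → x < z ∨ z < y)
| ax_rlt_tight (x y : tm G Real) : axiom G (¬ (x < y) → ¬ (y < x) → x = y)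
| ax_rlt_radd (x y z : tm G Real) : axiom G (x < y → x + z < y + z)
| ax_rlt_rmul (x y : tm G Real) : axiom G (0 < x → 0 < y → 0 < x * y)
| ax_rmax_l (x y : tm G Real) : axiom G (x <= rmax x y)
| ax_rmax_r (x y : tm G Real) : axiom G (y <= rmax x y)
| ax_rmax_lub (x y z : tm G Real) : axiom G (z < rmax x y → z < x ∨ z < y)
| ax_ofnat_zero : axiom G (ofnat zero = 0)
| ax_ofnat_succ (t : tm G Nat) : axiom G (ofnat (succ t) = ofnat t + 1)
| ax_archimedean (x : tm G Real) : axiom G (∃ n : Nat, #x < ofnat #n)
| ax_complete (x : tm G (Fun Nat Real)) :
    axiom G (cauchy x → ∃ l : Real, converges #x #l)
(* [Interval] is the set of all real numbers x with 0 <= x <= 1 *)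
| ax_incl_ge_zero (t : tm G Interval) : axiom G (0 <= incl t)
| ax_incl_le_one (t : tm G Interval) : axiom G (incl t <= 1)
| ax_incl_inj (t u : tm G Interval) : axiom G (incl t = incl u → t = u)
| ax_incl_surj (x : tm G Real) :
    axiom G (0 <= x → x <= 1 → ∃ t : Interval, incl #t = #x).

(** Natural deduction; [proves G H p]: [p] follows from the hypotheses [H], the free
    variables being those of [G]. *)
Inductive proves : forall G : ctx, list (fm G) -> fm G -> Prop :=
| pr_axiom G H p : axiom G p -> proves G H p
| pr_hyp G H p : In p H -> proves G H p
| pr_bot_elim G H p : proves G H ⊥ -> proves G H p
| pr_and_intro G H p q : proves G H p -> proves G H q -> proves G H (p ∧ q)
| pr_and_elim_l G H p q : proves G H (p ∧ q) -> proves G H p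
| pr_and_elim_r G H p q : proves G H (p ∧ q) -> proves G H q
| pr_or_intro_l G H p q : proves G H p -> proves G H (p ∨ q)
| pr_or_intro_r G H p q : proves G H q -> proves G H (p ∨ q)
| pr_or_elim G H p q r :
    proves G H (p ∨ q) -> proves G (p :: H) r -> proves G (q :: H) r -> proves G H r
| pr_imp_intro G H p q : proves G (p :: H) q -> proves G H (p → q)
| pr_imp_elim G H p q : proves G H (p → q) -> proves G H p -> proves G H q
| pr_all_intro G H s (p : fm (s :: G)) :
    proves (s :: G) (map wk H) p -> proves G H (All s p)
| pr_all_elim G H s (p : fm (s :: G)) (t : tm G s) :
    proves G H (All s p) -> proves G H (sub1 p t)
| pr_ex_intro G H s (p : fm (s :: G)) (t : tm G s) :
    proves G H (sub1 p t) -> proves G H (Ex s p)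
| pr_ex_elim G H s (p : fm (s :: G)) (q : fm G) :
    proves G H (Ex s p) -> proves (s :: G) (p :: map wk H) (wk q) -> proves G H q
| pr_eq_refl G H s (t : tm G s) : proves G H (t = t)
| pr_eq_elim G H s (p : fm (s :: G)) (t u : tm G s) :
    proves G H (t = u) -> proves G H (sub1 p t) -> proves G H (sub1 p u).

(** A principle that quantifies over arbitrary sets is a schema, hence a set of
    sentences.  [P] yields [Q] if each instance of [Q] follows from finitely many
    instances of [P]. *)
Definition principle : Type := sentence -> Prop.

Definition derivable_from (P Q : principle) : Prop :=
  forall q, Q q -> exists H : list sentence, (forall p, In p H -> P p) /\ proves [] H q.

Definition equivalent_over_BISH (P Q : principle) : Prop :=
  derivable_from P Q /\ derivable_from Q P.

Record space : Type := Space {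
  pt : sort;
  dist : forall G : ctx, tm G pt -> tm G pt -> tm G Real
}.
Arguments dist _ {G} _ _.

Definition unit_interval : space :=
  Space Interval (fun G t u => rabs (incl t - incl u)).

Definition pointwise_continuous (X : space) {G : ctx} (f : tm G (Fun (pt X) Real)) : fm G :=
  ∀ x : pt X, ∀ e : Real, 0 < #e →
    ∃ d : Real, 0 < #d ∧
      ∀ y : pt X, dist X #x #y < #d → rabs (#f @ #x - #f @ #y) < #e.

Definition is_inf (X : space) {G : ctx} (f : tm G (Fun (pt X) Real)) (m : tm G Real) : fm G :=
  (∀ x : pt X, #m <= #f @ #x) ∧
  (∀ e : Real, 0 < #e → ∃ x : pt X, #f @ #x < #m + #e).

Definition POS_p (X : space) : principle := fun p =>
  p = (∀ f : Fun (pt X) Real,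
         pointwise_continuous X #f →
         (∀ x : pt X, 0 < #f @ #x) →
         ∀ m : Real, is_inf X #f #m → 0 < #m)%B :> sentence.

Definition is_metric {s : sort} {G : ctx} (rho : tm G (Fun s (Fun s Real))) : fm G :=
  (∀ x : s, ∀ y : s, 0 <= #rho @ #x @ #y) ∧
  (∀ x : s, #rho @ #x @ #x = 0) ∧
  (∀ x : s, ∀ y : s, #rho @ #x @ #y = 0 → #x = #y) ∧
  (∀ x : s, ∀ y : s, #rho @ #x @ #y = #rho @ #y @ #x) ∧
  (∀ x : s, ∀ y : s, ∀ z : s, #rho @ #x @ #z <= #rho @ #x @ #y + #rho @ #y @ #z).

(** [X], identified with its image under [j], is a subspace of [(E, rho)]. *)
Definition is_isometry (X : space) {s : sort} {G : ctx}
    (rho : tm G (Fun s (Fun s Real))) (j : tm G (Fun (pt X) s)) : fm G :=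
  ∀ x : pt X, ∀ y : pt X, #rho @ (#j @ #x) @ (#j @ #y) = dist X #x #y.

(** [rho (w, X) > 0], so that [X] with [w] adjoined is a one-point extension of [X]. *)
Definition apart_from_space (X : space) {s : sort} {G : ctx}
    (rho : tm G (Fun s (Fun s Real))) (j : tm G (Fun (pt X) s)) (w : tm G s) : fm G :=
  ∃ d : Real, 0 < #d ∧ ∀ y : pt X, #d <= #rho @ #w @ (#j @ #y).

Definition eventually_bounded_away {s : sort} {G : ctx}
    (rho : tm G (Fun s (Fun s Real))) (u : tm G (Fun Nat s)) (x : tm G s) : fm G :=
  ∃ N : Nat, ∃ d : Real, 0 < #d ∧
    ∀ n : Nat, #N ≼ #n → #d <= #rho @ #x @ (#u @ #n).

(** One instance for each set [E] that may carry a one-point extension of [X]. *)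
Definition AS_L (X : space) : principle := fun p =>
  exists E : sort,
  p = (∀ rho : Fun E (Fun E Real), ∀ j : Fun (pt X) E, ∀ w : E,
         is_metric #rho →
         is_isometry X #rho #j →
         apart_from_space X #rho #j #w →
         ∀ u : Fun Nat E,
           (∀ n : Nat, (∃ x : pt X, #u @ #n = #j @ #x) ∨ #u @ #n = #w) →
           (∀ x : pt X, eventually_bounded_away #rho #u (#j @ #x)) →
           ∃ n : Nat, #u @ #n = #w)%B :> sentence.

(* Main.v *)
(** Formal derivations are produced by a forcing semantics.  A world is a finite list of
    hypotheses in which variables have been replaced by terms over an infinite supply of
    names, and it forces a formula exactly when it proves it; in the forcing relation
    quantifiers range over a constant domain of terms and implications over extensions of
    the world, so that a derivation becomes an ordinary mathematical argument.

    Positivity from the anti-Specker property: extend [0,1] by w = 2.  For each n, either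
    0 < m or m < 1 / (n + 1), where m is the infimum of f; choose u_n = w in the first case,
    and u_n in [0,1] with f(u_n) < 1 / (n + 1) in the second.  Since f is continuous and
    positive, u is eventually bounded away from each point of [0,1], so some u_n is w.

    Conversely, let u be eventually bounded away from each point of [0,1].  Put g_k = 1 / (k + 1)
    and b_k = k as long as no term up to u_k is w, and g_k = 1, b_k = 0 afterwards, and let
    f(x) be the infimum over k of g_k + b_k |x - u_k|.  As |x - u_k| is bounded below for large
    k, only finitely many k matter near x, so f is defined, positive and continuous; its
    infimum is the infimum of the g_k, which exists because either w occurs or g_k tends to 0.
    If that infimum is positive, then some g_k differs from 1 / (k + 1), so w occurs. *)

From Stdlib Require Import List Arith Lia Setoid Morphisms ZArith Ring_polynom InitialRing
  Ring_theory Bool.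
Require Import Defs.
Import ListNotations.

(** * Substitution *)

(** In the calculus every quantifier rule changes the context; names avoid this, since a name that
    does not occur in a world acts as a generic element of its sort. The obstacle is that sorts are
    not assumed inhabited, and an inhabited sort such as [Interval] need not have a closed term,
    whereas a name must have a value. Hence everything is relative to a base context [B] whose
    variables inhabit the sorts that the argument uses; these variables are discharged at the end by
    proving that such elements exist. In the function built from u, stage 0 always has g_0 = 1 and
    b_0 = 0, so f is at most 1 and every k whose term is at least 1 near x can be ignored there. The
    slopes b_k = k are unbounded because the distance kept from u_k may be arbitrarily small:
    distance c makes the term at least 1 as soon as k c >= 1. The steepness does not harm
    continuity, for near each point only finitely many slopes count. *)

Lemma var_cons_ind {G r} (P : forall s, var (r :: G) s -> Prop) :
  P r vz -> (forall s v, P s (vs v)) -> forall s v, P s v.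
Proof.
  intros H0 H1 s v.
  (* The predicate is passed through the match, so that its type follows the refined context and no
     axiom about equality of indices enters. *)
  refine (match v as v' in var G' s' return
    match G' return forall s'', var G' s'' -> Prop with
    | [] => fun _ _ => True
    | r0 :: G0 => fun s'' v'' => forall P : forall s, var (r0 :: G0) s -> Prop,
        P r0 vz -> (forall s v, P s (vs v)) -> P s'' v''
    end s' v' with vz => _ | vs w => _ end P H0 H1); auto.
Qed.

Lemma tm_sub_ext {G D} (f g : substitution G D) :
  (forall s v, f s v = g s v) -> forall s (t : tm G s), tm_sub f t = tm_sub g t.
Proof. intros e s t; induction t; cbn; congruence. Qed.

Lemma sup_ext {G D} r (f g : substitution G D) :
  (forall s v, f s v = g s v) -> forall s v, @sup G D r f s v = sup g s v.
Proof. intros e; apply var_cons_ind; cbn; congruence. Qed.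

Lemma fm_sub_ext {G} (p : fm G) : forall D (f g : substitution G D),
  (forall s v, f s v = g s v) -> fm_sub f p = fm_sub g p.
Proof.
  induction p; intros D f g e; cbn; f_equal; eauto using tm_sub_ext, sup_ext.
Qed.

Lemma tm_ren_sub {G D} (f : renaming G D) s (t : tm G s) :
  tm_ren f t = tm_sub (fun s v => Var (f s v)) t.
Proof. induction t; cbn; congruence. Qed.

Lemma fm_ren_sub {G} (p : fm G) : forall D (f : renaming G D),
  fm_ren f p = fm_sub (fun s v => Var (f s v)) p.
Proof.
  induction p; intros D f; cbn; f_equal; eauto using tm_ren_sub;
    rewrite IHp; apply fm_sub_ext; apply var_cons_ind; reflexivity.
Qed.

Lemma tm_sub_sub {G D F} (f : substitution G D) (g : substitution D F) s (t : tm G s) :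
  tm_sub g (tm_sub f t) = tm_sub (fun s v => tm_sub g (f s v)) t.
Proof. induction t; cbn; congruence. Qed.

Lemma tm_sub_wk {G D} r (f : substitution G D) s (t : tm G s) :
  tm_sub (@sup G D r f) (tm_ren (fun _ => vs) t) = tm_ren (fun _ => vs) (tm_sub f t).
Proof. rewrite !tm_ren_sub, !tm_sub_sub; apply tm_sub_ext; intros; cbn; apply tm_ren_sub. Qed.

Lemma fm_sub_sub {G} (p : fm G) : forall D F (f : substitution G D) (g : substitution D F),
  fm_sub g (fm_sub f p) = fm_sub (fun s v => tm_sub g (f s v)) p.
Proof.
  induction p; intros D F f g; cbn; f_equal; eauto using tm_sub_sub;
    rewrite IHp; apply fm_sub_ext; apply var_cons_ind; cbn; intros; auto using tm_sub_wk.
Qed.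

Lemma tm_sub_id {G s} (t : tm G s) : tm_sub (fun _ => Var) t = t.
Proof. induction t; cbn; congruence. Qed.

Lemma proves_incl {G H p} : proves G H p -> forall H', List.incl H H' -> proves G H' p.
Proof.
  induction 1; intros H' i.
  - now apply pr_axiom.
  - apply pr_hyp; auto.
  - apply pr_bot_elim; auto.
  - apply pr_and_intro; auto.
  - eapply pr_and_elim_l; eauto.
  - eapply pr_and_elim_r; eauto.
  - apply pr_or_intro_l; auto.
  - apply pr_or_intro_r; auto.
  - eapply pr_or_elim; [eauto | apply IHproves2 | apply IHproves3];
      apply incl_cons; cbn; auto using incl_tl.
  - apply pr_imp_intro, IHproves, incl_cons; cbn; auto using incl_tl.
  - eapply pr_imp_elim; eauto.
  - apply pr_all_intro, IHproves, incl_map, i.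
  - apply pr_all_elim; auto.
  - eapply pr_ex_intro; eauto.
  - eapply pr_ex_elim; [eauto | apply IHproves2].
    apply incl_cons; cbn; auto using incl_tl, incl_map.
  - apply pr_eq_refl.
  - eapply pr_eq_elim; eauto.
Qed.

Ltac expand := cbv beta delta [sub1 sub2 ex_unique cauchy converges nat_le rabs rmax
  radd ropp rmul ofnat succ zero rzero rone incl tpair tfst tsnd all_hoas ex_hoas
  lift emb ext_cons ext_refl].

(** Every axiom is a schema, so substituting into an instance gives the instance at the substituted
    parameters. This is what lets axioms be used at names. *)
Lemma axiom_sub {G p} : axiom G p -> forall D (f : substitution G D), axiom D (fm_sub f p).
Proof.
  destruct 1; intros D f0; try solve [cbn; constructor].
  all: expand; cbn; rewrite ?tm_sub_wk.
  all: try solve [constructor].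
  (* Here the two formulas agree only up to composition of substitutions, so the instance is named
     and the equation is proved afterwards. *)
  1: refine (eq_ind _ (axiom D) (ax_induction D (fm_sub (sup f0) p)) _ _).
  2: refine (eq_ind _ (axiom D) (ax_fun_ex D a b (fm_sub (sup (sup f0)) p)) _ _).
  3: refine (eq_ind _ (axiom D) (ax_dependent_choice D a (fm_sub (sup f0) p)
       (fm_sub (sup (sup f0)) q)) _ _).
  4: refine (eq_ind _ (axiom D) (ax_complete D (tm_sub f0 x)) _ _).
  all: expand; cbn.
  all: repeat match goal with |- _ = _ :> fm _ => f_equal end.
  all: rewrite ?fm_sub_sub; try apply fm_sub_ext.
  all: repeat (apply var_cons_ind; cbn; auto).
  all: intros; rewrite ?tm_ren_sub, ?tm_sub_sub; cbn.
  all: repeat match goal with |- App _ _ = App _ _ => f_equal end.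
  all: rewrite ?tm_ren_sub, ?tm_sub_sub; cbn; auto.
  all: try (rewrite <- tm_sub_id; apply tm_sub_ext; reflexivity).
  all: try (apply tm_sub_ext; intros; rewrite ?tm_ren_sub, ?tm_sub_sub; reflexivity).
Qed.

(** * Forcing *)

Definition sort_eq_dec (a b : sort) : {a = b} + {a <> b}.
Proof. decide equality; apply Nat.eq_dec. Defined.

Section Forcing.
Context {B : ctx}.

(* A name is determined by its sort and number; [d] is the term of the base context [B] that it
   stands for by default. *)
Inductive nt : sort -> Type :=
| NV (s : sort) (d : tm B s) (n : nat) : nt s
| NC (s : sort) : cst s -> nt s
| NA (a b : sort) : nt (Fun a b) -> nt a -> nt b.
Arguments NV {s}. Arguments NC {s}. Arguments NA {a b}.

Fixpoint env (D : ctx) : Type :=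
  match D with [] => unit | s :: D' => (nt s * env D')%type end.

Fixpoint look {D s} (v : var D s) : env D -> nt s :=
  match v with vz => fst | vs w => fun e => look w (snd e) end.

Fixpoint tden {D s} (t : tm D s) (e : env D) : nt s :=
  match t with
  | Var v => look v e
  | Cst c => NC c
  | App t u => NA (tden t e) (tden u e)
  end.

Definition assignment (G : ctx) : Type := forall s, tm B s -> nat -> tm G s.

Fixpoint val {G} (a : assignment G) {s} (t : nt s) : tm G s :=
  match t with
  | NV d n => a _ d n
  | NC c => Cst c
  | NA t u => App (val a t) (val a u)
  end.

Definition env_val {G D} (a : assignment G) (e : env D) : substitution D G :=
  fun s v => val a (look v e).

Lemma val_tden {G D s} (a : assignment G) (t : tm D s) (e : env D) :
  val a (tden t e) = tm_sub (env_val a e) t.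
Proof. induction t; cbn; auto; now rewrite IHt1, IHt2. Qed.

(** Pairing a formula with an environment delays substitution, so that formulas over names need no
    syntax or substitution theory of their own. *)
Record closure : Type := Cl { cl_ctx : ctx; cl_fm : fm cl_ctx; cl_env : env cl_ctx }.
Arguments Cl {cl_ctx}.

Definition cl_val {G} (a : assignment G) (c : closure) : fm G :=
  fm_sub (env_val a (cl_env c)) (cl_fm c).

Definition world : Type := list closure.

(** Quantifying over all contexts and assignments makes names behave like free variables. *)
Definition entails (W : world) (c : closure) : Prop :=
  forall G (a : assignment G), proves G (map (cl_val a) W) (cl_val a c).

Lemma entails_incl {W c} W' : List.incl W W' -> entails W c -> entails W' c.
Proof. intros i h G a. exact (proves_incl (h G a) _ (incl_map _ i)). Qed.

Fixpoint bound {s} (t : nt s) : nat :=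
  match t with NV _ n => S n | NC _ => 0 | NA t u => max (bound t) (bound u) end.

Fixpoint env_bound {D} : env D -> nat :=
  match D with [] => fun _ => 0 | _ :: _ => fun e => max (bound (fst e)) (env_bound (snd e)) end.

Definition world_bound (W : world) : nat := list_max (map (fun c => env_bound (cl_env c)) W).

(** All names of sort [s] and number [n], whatever their default, are sent to the new variable;
    other names keep their value, weakened. *)
Definition fresh_assign {G} (a : assignment G) (n : nat) (s : sort) : assignment (s :: G) :=
  fun s' d m =>
    if Nat.eq_dec m n then
      match sort_eq_dec s s' with
      | left e => eq_rect s (fun r => tm (s :: G) r) (Var vz) s' e
      | right _ => tm_ren (fun _ => vs) (a s' d m)
      end
    else tm_ren (fun _ => vs) (a s' d m).

Lemma fresh_assign_self {G} (a : assignment G) n s d : fresh_assign a n s s d n = Var vz.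
Proof.
  unfold fresh_assign; destruct (Nat.eq_dec n n) as [_|]; [|congruence].
  destruct (sort_eq_dec s s) as [e|]; [|congruence].
  now rewrite (Eqdep_dec.UIP_dec sort_eq_dec e eq_refl).
Qed.

Lemma val_fresh {G} (a : assignment G) n s r (t : nt r) :
  bound t <= n -> val (fresh_assign a n s) t = tm_ren (fun _ => vs) (val a t).
Proof.
  induction t; cbn; intro h; auto.
  - unfold fresh_assign; destruct (Nat.eq_dec _ _); auto; lia.
  - rewrite IHt1, IHt2; auto; lia.
Qed.

Lemma env_val_fresh {G} (a : assignment G) n s {D} (e : env D) : env_bound e <= n ->
  forall r (v : var D r), env_val (fresh_assign a n s) e r v = tm_ren (fun _ => vs)
    (env_val a e r v).
Proof.
  induction D as [|r0 D IH]; intros h; [intros r v; inversion v|].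
  cbn in h. apply var_cons_ind; [|intros r v]; cbn.
  - apply val_fresh; lia.
  - apply (IH (snd e)); lia.
Qed.

Lemma cl_val_fresh {G} (a : assignment G) n s (c : closure) :
  env_bound (cl_env c) <= n -> cl_val (fresh_assign a n s) c = wk (cl_val a c).
Proof.
  intro h; unfold cl_val, wk; rewrite fm_ren_sub, fm_sub_sub; apply fm_sub_ext.
  intros; rewrite env_val_fresh, tm_ren_sub by auto; reflexivity.
Qed.

Lemma world_val_fresh {G} (a : assignment G) n s (W : world) :
  world_bound W <= n -> map (cl_val (fresh_assign a n s)) W = map wk (map (cl_val a) W).
Proof.
  intro h; rewrite map_map; apply map_ext_in; intros c hc; apply cl_val_fresh.
  unfold world_bound in h; rewrite list_max_le, Forall_map, Forall_forall in h; auto.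
Qed.

Lemma cl_val_cons_fresh {G D s} (a : assignment G) n (d : tm B s) (p : fm (s :: D)) (e : env D) :
  env_bound e <= n ->
  cl_val (fresh_assign a n s) (@Cl (s :: D) p (NV d n, e)) = fm_sub (sup (env_val a e)) p.
Proof.
  intro h; apply fm_sub_ext; apply var_cons_ind; [|intros r v]; cbn.
  - apply fresh_assign_self.
  - now apply env_val_fresh.
Qed.

Lemma cl_val_cons {G D s} (a : assignment G) (t : nt s) (p : fm (s :: D)) (e : env D) :
  cl_val a (@Cl (s :: D) p (t, e)) = sub1 (fm_sub (sup (env_val a e)) p) (val a t).
Proof.
  unfold cl_val, sub1; cbn; rewrite fm_sub_sub; apply fm_sub_ext; apply var_cons_ind; cbn; auto.
  intros r v; rewrite tm_ren_sub, tm_sub_sub; symmetry; apply tm_sub_id.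
Qed.

(** From right to left, the instance at a fresh name suffices: an assignment that sends this name to
    the new variable turns the instance into the premise of generalisation. The term [d] is only the
    default that such a name must carry. *)
Lemma entails_all {W D s} (d : tm B s) (p : fm (s :: D)) (e : env D) :
  entails W (Cl (All s p) e) <-> forall t, entails W (@Cl (s :: D) p (t, e)).
Proof.
  split.
  - intros h t G a; rewrite cl_val_cons; apply pr_all_elim, (h G a).
  - intros h G a. set (n := max (world_bound W) (env_bound e)).
    apply (pr_all_intro _ _ s (fm_sub (sup (env_val a e)) p)).
    rewrite <- (world_val_fresh a n s) by (unfold n; lia).
    rewrite <- (cl_val_cons_fresh a n d p e) by (unfold n; lia). apply h.
Qed.

Lemma entails_ex_intro {W D s} (p : fm (s :: D)) (e : env D) t :
  entails W (@Cl (s :: D) p (t, e)) -> entails W (Cl (Ex s p) e).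
Proof. intros h G a. eapply pr_ex_intro. rewrite <- (cl_val_cons a t). apply h. Qed.

Lemma entails_ex_elim {W D s} (d : tm B s) (p : fm (s :: D)) (e : env D) c :
  entails W (Cl (Ex s p) e) -> (forall t, entails (@Cl (s :: D) p (t, e) :: W) c) -> entails W c.
Proof.
  intros h k G a. set (n := max (max (world_bound W) (env_bound e)) (env_bound (cl_env c))).
  apply (pr_ex_elim _ _ s (fm_sub (sup (env_val a e)) p)); [exact (h G a)|].
  rewrite <- (cl_val_cons_fresh a n d p e), <- (world_val_fresh a n s), <- (cl_val_fresh a n s)
    by (unfold n; lia).
  apply (k (NV d n)).
Qed.

(** Binders are functions on names, so that instances of quantified formulas are computed instead of
    being handled by substitution lemmas. *)
Inductive nfm : Type :=
| nBot
| nEq (s : sort) (t u : nt s)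
| nLt (t u : nt Real)
| nAnd (p q : nfm)
| nOr (p q : nfm)
| nImp (p q : nfm)
| nAll (s : sort) (p : nt s -> nfm)
| nEx (s : sort) (p : nt s -> nfm).
Arguments nEq {s}.

Fixpoint den {D} (p : fm D) (e : env D) : nfm :=
  match p with
  | Bot => nBot
  | Eq t u => nEq (tden t e) (tden u e)
  | Lt t u => nLt (tden t e) (tden u e)
  | And p q => nAnd (den p e) (den q e)
  | Or p q => nOr (den p e) (den q e)
  | Imp p q => nImp (den p e) (den q e)
  | All s p => nAll s (fun x => @den (s :: D) p (x, e))
  | Ex s p => nEx s (fun x => @den (s :: D) p (x, e))
  end.

(* As in Beth semantics, [X] need only hold after the disjunctions and existential formulas
   provable in [W] have been eliminated. *)
Definition cover (W : world) (X : world -> Prop) : Prop :=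
  forall c W', List.incl W W' -> (forall W'', List.incl W' W'' -> X W'' -> entails W'' c) ->
    entails W' c.

Fixpoint forces (W : world) (p : nfm) {struct p} : Prop :=
  match p with
  | nBot => entails W (@Cl [] Bot tt)
  | @nEq s t u => entails W (@Cl [s; s] (Eq (Var vz) (Var (vs vz))) (t, (u, tt)))
  | nLt t u => entails W (@Cl [Real; Real] (Lt (Var vz) (Var (vs vz))) (t, (u, tt)))
  | nAnd p q => forces W p /\ forces W q
  | nOr p q => cover W (fun W' => forces W' p \/ forces W' q)
  | nImp p q => forall W', List.incl W W' -> forces W' p -> forces W' q
  | nAll s p => forall x, forces W (p x)
  | nEx s p => cover W (fun W' => exists x, forces W' (p x))
  end.

Lemma forces_incl p : forall W W', List.incl W W' -> forces W p -> forces W' p.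
Proof.
  induction p; cbn; intros W W' i h; eauto using entails_incl.
  - destruct h; eauto.
  - intros c W'' i'; apply h; eauto using incl_tran.
  - eauto using incl_tran.
  - intros c W'' i'; apply h; eauto using incl_tran.
Qed.

(** Forcing is local: entailments pass through a cover by definition, disjunctions and existentials
    are themselves covers and covers compose, and the other connectives inherit the property. All
    elimination rules rest on this. *)
Lemma cover_elim p : forall W (X : world -> Prop), cover W X ->
  (forall W', List.incl W W' -> X W' -> forces W' p) -> forces W p.
Proof.
  assert (L : forall W (X Y : world -> Prop), cover W X ->
    (forall W', List.incl W W' -> X W' -> cover W' Y) -> cover W Y).
  { intros W X Y h k c W' i l. apply h; auto.
    intros W'' i' x. apply (k W''); eauto using incl_tran, incl_refl. }
  induction p; cbn; intros W X h k.
  - apply h; auto using incl_refl.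
  - apply h; auto using incl_refl.
  - apply h; auto using incl_refl.
  - split; [apply (IHp1 W X) | apply (IHp2 W X)]; auto; apply k.
  - apply (L W X); auto.
  - intros W' i hp. apply (IHp2 W' X).
    + intros c W'' i'. apply h; eauto using incl_tran.
    + intros W'' i' x. apply (k W''); eauto using incl_tran, incl_refl, forces_incl.
  - intro x. apply (H x W X); [exact h|]. intros W' i' x'; exact (k W' i' x' x).
  - apply (L W X); auto.
Qed.

Lemma cover_iff W (X Y : world -> Prop) :
  (forall W', List.incl W W' -> X W' <-> Y W') -> cover W X <-> cover W Y.
Proof.
  intro h; split; intros k c W' i l; apply k; auto; intros W'' j x; apply l; auto;
    apply h; eauto using incl_tran.
Qed.

Lemma cover_now W (X : world -> Prop) :
  (forall W', List.incl W W' -> X W') -> cover W X.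
Proof. intros h c W' i k. apply k; auto using incl_refl. Qed.

(* Names take their values in contexts extending [B], so the sorts of quantified
   variables must be inhabited there. *)
Fixpoint okf {D} (p : fm D) : Prop :=
  match p with
  | Bot | Eq _ _ | Lt _ _ => True
  | And p q | Or p q | Imp p q => okf p /\ okf q
  | All s p | Ex s p => inhabited (tm B s) /\ okf p
  end.

(** For an implication, the world enlarged by the premise is the critical extension. For a
    disjunction or an existential formula, the worlds enlarged by a disjunct or by an instance form
    a cover, by the elimination rules of the calculus. *)
Lemma forces_den {D} (p : fm D) : okf p ->
  forall (e : env D) W, forces W (den p e) <-> entails W (Cl p e).
Proof.
  induction p; cbn [okf]; intros ok e W;
    try match type of ok with _ /\ _ => destruct ok as [ok1 ok2] end.
  - split; intros h G0 a; exact (h G0 a).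
  - split; intros h G0 a; specialize (h G0 a); cbn in h |- *; unfold cl_val in *; cbn in *;
      unfold env_val in h; cbn in h; rewrite ?val_tden in *; auto;
      unfold env_val at 2 3; cbn; rewrite ?val_tden; auto.
  - split; intros h G0 a; specialize (h G0 a); cbn in h |- *; unfold cl_val in *; cbn in *;
      unfold env_val in h; cbn in h; rewrite ?val_tden in *; auto;
      unfold env_val at 2 3; cbn; rewrite ?val_tden; auto.
  - cbn [den forces]; rewrite IHp1, IHp2 by auto; split.
    + intros [h k] G0 a; apply pr_and_intro; [apply h | apply k].
    + intro h; split; intros G0 a; [eapply pr_and_elim_l | eapply pr_and_elim_r]; apply (h G0 a).
  - cbn [den forces]; split.
    + intro h. apply (h _ W); auto using incl_refl.
      intros W' _ [k|k]; [apply IHp1 in k | apply IHp2 in k]; auto; intros G0 a.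
      * apply pr_or_intro_l, k.
      * apply pr_or_intro_r, k.
    + intros h c W' i k G0 a. eapply pr_or_elim.
      * apply (entails_incl _ i h G0 a).
      * apply (k (Cl p1 e :: W')); [apply incl_tl, incl_refl|]. left; apply IHp1; auto.
        intros G1 a1; apply pr_hyp; left; auto.
      * apply (k (Cl p2 e :: W')); [apply incl_tl, incl_refl|]. right; apply IHp2; auto.
        intros G1 a1; apply pr_hyp; left; auto.
  - cbn [den forces]; split.
    + intros h G0 a. apply pr_imp_intro.
      refine (proj1 (IHp2 ok2 e (Cl p1 e :: W)) _ G0 a).
      apply h; [apply incl_tl, incl_refl|]. apply IHp1; auto.
      intros G1 a1; apply pr_hyp; left; auto.
    + intros h W' i k. apply IHp2; auto. apply IHp1 in k; auto. intros G0 a.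
      eapply pr_imp_elim; [apply (entails_incl _ i h G0 a) | apply k].
  - cbn [den forces]. destruct ok1 as [d]. rewrite (entails_all d).
    split; intros h t; apply (IHp ok2 (t, e)); auto.
  - cbn [den forces]. destruct ok1 as [d]. split.
    + intro h. apply (h _ W); auto using incl_refl.
      intros W' _ [t k]. apply (IHp ok2 (t, e)) in k. eapply entails_ex_intro; eauto.
    + intros h c W' i k. apply (entails_ex_elim d p e); [eauto using entails_incl|].
      intro t. apply k; [apply incl_tl, incl_refl|]. exists t. apply (IHp ok2 (t, e)).
      intros G1 a1; apply pr_hyp; left; auto.
Qed.

Lemma tden_sub {D F} (f : substitution D F) (e : env F) (e' : env D) :
  (forall s v, tden (f s v) e = look v e') ->
    forall s (t : tm D s), tden (tm_sub f t) e = tden t e'.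
Proof. intros h s t; induction t; cbn; auto; congruence. Qed.

Lemma tden_wk {D r s} (t : tm D s) (x : nt r) (e : env D) :
  @tden (r :: D) _ (tm_ren (fun _ => vs) t) (x, e) = tden t e.
Proof. rewrite tm_ren_sub; now apply tden_sub. Qed.

Lemma forces_sub {D} (p : fm D) : forall F (f : substitution D F) (e : env F) (e' : env D),
  (forall s v, tden (f s v) e = look v e') ->
  forall W, forces W (den (fm_sub f p) e) <-> forces W (den p e').
Proof.
  assert (U : forall D F r (f : substitution D F) (e : env F) (e' : env D) (x : nt r),
    (forall s v, tden (f s v) e = look v e') ->
    forall s v, @tden (r :: F) _ (sup f s v) (x, e) = @look (r :: D) _ v (x, e')).
  { intros D0 F r f e e' x h; apply var_cons_ind; cbn; auto.
    intros; rewrite tden_wk; auto. }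
  induction p; intros F f e e' h W; cbn; rewrite ?(tden_sub f e e' h); try reflexivity.
  - rewrite (IHp1 _ f e e'), (IHp2 _ f e e'); auto; reflexivity.
  - apply cover_iff; intros; rewrite (IHp1 _ f e e'), (IHp2 _ f e e'); auto; reflexivity.
  - split; intros k W' i l; apply (IHp2 _ f e e' h); apply k; auto; apply (IHp1 _ f e e' h); auto.
  - split; intros k x; apply (IHp _ (sup f) (x, e) (x, e')); auto.
  - apply cover_iff; intros; split; intros [x k]; exists x; apply (IHp _ (sup f) (x, e) (x, e'));
      auto.
Qed.

(** Axioms need no semantic verification: they are provable, hence forced. *)
Lemma forces_axiom {D p} (ax : axiom D p) : okf p -> forall W (e : env D), forces W (den p e).
Proof.
  intros ok W e. apply forces_den; auto. intros G a. apply pr_axiom. now apply axiom_sub.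
Qed.

Fixpoint base_env {D : ctx} : substitution D B -> env D :=
  match D with
  | [] => fun _ => tt
  | s :: D' => fun f => (NV (f s vz) 0, base_env (fun r v => f r (vs v)))
  end.

Lemma look_base {D} (f : substitution D B) :
  forall s v, val (fun s d n => d) (look v (base_env f)) = f s v.
Proof.
  induction D as [|r D IH]; [intros s v; inversion v|].
  apply var_cons_ind; cbn; auto. intros s v; apply IH.
Qed.

(** In [base_env f] each variable is a name whose default is its value under [f]; evaluating all
    names at their defaults turns the entailment into a derivation over [B]. *)
Lemma adequacy {D} (p : fm D) : okf p -> (forall e : env D, forces [] (den p e)) ->
  forall f : substitution D B, proves B [] (fm_sub f p).
Proof.
  intros ok h f. specialize (h (base_env f)).
  apply forces_den in h; auto. specialize (h B (fun s d n => d)); cbn in h.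
  erewrite fm_sub_ext; [exact h|]. intros; symmetry; apply look_base.
Qed.

End Forcing.

(** * Reasoning inside the forcing relation *)

Arguments nt B s : clear implicits.
Arguments NV {B s}. Arguments NC {B s}. Arguments NA {B a b}.
Arguments env B D : clear implicits.
Arguments nfm B : clear implicits.
Arguments world B : clear implicits.
Arguments Cl {B cl_ctx}.
Arguments nBot {B}.
Arguments nEq {B s}.
Arguments nAll {B} s p.
Arguments nEx {B} s p.

Declare Scope nt_scope.
Delimit Scope nt_scope with nt.
Bind Scope nt_scope with nt.
Bind Scope nt_scope with nfm.
Open Scope nt_scope.

Notation "f @ t" := (NA f t) (at level 11, left associativity) : nt_scope.
Notation "⊥" := nBot (at level 0) : nt_scope.
Notation "t = u" := (nEq t u) : nt_scope.
Notation "t < u" := (nLt t u) : nt_scope.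
Notation "p ∧ q" := (nAnd p q) (at level 80, right associativity) : nt_scope.
Notation "p ∨ q" := (nOr p q) (at level 85, right associativity) : nt_scope.
Notation "p → q" := (nImp p q) (at level 99, q at level 200, right associativity) : nt_scope.
Notation "∀ x : s , p" := (nAll s (fun x => p))
  (at level 200, x name, s at level 99, p at level 200, right associativity) : nt_scope.
Notation "∃ x : s , p" := (nEx s (fun x => p))
  (at level 200, x name, s at level 99, p at level 200, right associativity) : nt_scope.
Notation "0" := (NC c_rzero) : nt_scope.
Notation "1" := (NC c_rone) : nt_scope.
Notation "t + u" := (NA (NA (NC c_radd) t) u) : nt_scope.
Notation "- t" := (NA (NC c_ropp) t) : nt_scope.
Notation "t - u" := (NA (NA (NC c_radd) t) (NA (NC c_ropp) u)) : nt_scope.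
Notation "t * u" := (NA (NA (NC c_rmul) t) u) : nt_scope.
Notation "t <= u" := (nImp (nLt u t) nBot) : nt_scope.
Notation rmaxn t u := (NA (NA (NC c_rmax) t) u).
Notation rabsn t := (rmaxn t (NA (NC c_ropp) t)).
Notation zeron := (NC c_zero).
Notation succn t := (NA (NC c_succ) t).
Notation ofnatn t := (NA (NC c_ofnat) t).
Notation incln t := (NA (NC c_incl) t).
Notation "t ≼ u" := (nImp (nLt (ofnatn u) (ofnatn t)) nBot) (at level 70) : nt_scope.
Notation pairn t u := (NA (NA (NC (c_pair _ _)) t) u).
Notation fstn t := (NA (NC (c_fst _ _)) t).
Notation sndn t := (NA (NC (c_snd _ _)) t).
Notation "W ⊩ p" := (forces W p%nt) (at level 90, p at level 89, no associativity) : type_scope.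

Section Rules.
Context {B : ctx}.
Implicit Type W : world B.

Lemma imp_e {W} {p q : nfm B} : W ⊩ (p → q) -> W ⊩ p -> W ⊩ q.
Proof. intros h k; exact (h W (List.incl_refl W) k). Qed.

Lemma all_e {W s} {p : nt B s -> nfm B} : W ⊩ nAll s p -> forall t, W ⊩ p t.
Proof. auto. Qed.

Lemma and_i {W} {p q : nfm B} : W ⊩ p -> W ⊩ q -> W ⊩ p ∧ q.
Proof. exact (fun h k => conj h k). Qed.

Lemma or_l {W} {p q : nfm B} : W ⊩ p -> W ⊩ p ∨ q.
Proof. intro h; apply cover_now; intros W' i; left; exact (forces_incl _ _ _ i h). Qed.

Lemma or_r {W} {p q : nfm B} : W ⊩ q -> W ⊩ p ∨ q.
Proof. intro h; apply cover_now; intros W' i; right; exact (forces_incl _ _ _ i h). Qed.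

Lemma ex_i {W s} {p : nt B s -> nfm B} t : W ⊩ p t -> W ⊩ nEx s p.
Proof. intro h; apply cover_now; intros W' i; exists t; exact (forces_incl _ _ _ i h). Qed.

Lemma or_e {W} {p q : nfm B} r : W ⊩ p ∨ q ->
  (forall W', List.incl W W' -> (W' ⊩ p) \/ (W' ⊩ q) -> W' ⊩ r) -> W ⊩ r.
Proof. exact (cover_elim r W _). Qed.

Lemma ex_e {W s} {p : nt B s -> nfm B} r : W ⊩ nEx s p ->
  (forall W', List.incl W W' -> (exists x, W' ⊩ p x) -> W' ⊩ r) -> W ⊩ r.
Proof. exact (cover_elim r W _). Qed.

Lemma ex_falso {W} p : W ⊩ nBot -> W ⊩ p.
Proof.
  intro h. apply (cover_elim p W (fun _ => False)); [|tauto].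
  intros c W' i _ G a. apply pr_bot_elim, (entails_incl _ i h G a).
Qed.

(** Forced equality of names (not inequality), as a relation for setoid rewriting. Its companion
    [fequiv] asks for equivalence in every extension, because implication looks at extensions. *)
Definition neq W s (t u : nt B s) : Prop := W ⊩ t = u.
Definition fequiv W (p q : nfm B) : Prop :=
  forall W', List.incl W W' -> (forces W' p <-> forces W' q).

Lemma neq_incl {W s} {t u : nt B s} W' : List.incl W W' -> neq W s t u -> neq W' s t u.
Proof. apply forces_incl. Qed.

Lemma entails_eq {W D s} (p : fm (s :: D)) (e : env B D) t u :
  neq W s t u -> entails W (@Cl _ (s :: D) p (t, e)) -> entails W (@Cl _ (s :: D) p (u, e)).
Proof.
  intros h k G a. rewrite cl_val_cons. eapply pr_eq_elim; [exact (h G a)|].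
  cbn. rewrite <- cl_val_cons. apply k.
Qed.

#[local] Notation v0 := (Var vz).
#[local] Notation v1 := (Var (vs vz)).
#[local] Notation v2 := (Var (vs (vs vz))).

#[global] Instance neq_equivalence W s : Equivalence (neq W s).
Proof.
  assert (R : forall t : nt B s, neq W s t t) by (intros t G a; apply pr_eq_refl).
  assert (S : forall t u : nt B s, neq W s t u -> neq W s u t).
  { intros t u h. exact (entails_eq (D := [s]) (Eq v0 v1) (t, tt) t u h (R t)). }
  split; [exact R | exact S |].
  intros t u v h k. exact (entails_eq (D := [s]) (Eq v0 v1) (v, tt) u t (S _ _ h) k).
Qed.

Lemma ieq_sym {W s} {t u : nt B s} : W ⊩ t = u -> W ⊩ u = t.
Proof. apply (symmetry (R := neq W s)). Qed.

Lemma ieq_trans {W s} {t u v : nt B s} : W ⊩ t = u -> W ⊩ u = v -> W ⊩ t = v.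
Proof. apply (transitivity (R := neq W s)). Qed.

Lemma ieq_refl {W s} {t : nt B s} : W ⊩ t = t.
Proof. apply (reflexivity (R := neq W s)). Qed.

#[global] Instance app_proper W a b : Proper (neq W _ ==> neq W a ==> neq W b) NA.
Proof.
  intros f g h t u k. transitivity (f @ u).
  - exact (entails_eq (D := [a; Fun a b]) (Eq (App v2 v1) (App v2 v0)) (t, (f, tt)) t u k
      (reflexivity (R := neq W b) (f @ t))).
  - exact (entails_eq (D := [Fun a b; a]) (Eq (App v1 v2) (App v0 v2)) (f, (u, tt)) f g h
      (reflexivity (R := neq W b) (f @ u))).
Qed.

#[global] Instance lt_proper W : Proper (neq W _ ==> neq W _ ==> fequiv W) nLt.
Proof.
  assert (L : forall W x y z w, neq W _ x y -> neq W _ z w -> W ⊩ x < z -> W ⊩ y < w).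
  { intros W' x y z w h k l.
    apply (entails_eq (D := [Real]) (Lt v1 v0) (y, tt) z w k).
    exact (entails_eq (D := [Real]) (Lt v0 v1) (z, tt) x y h l). }
  intros x y h z w k W' i; apply (neq_incl W' i) in h, k.
  split; apply L; auto; symmetry; auto.
Qed.

#[global] Instance eq_proper W s : Proper (neq W _ ==> neq W _ ==> fequiv W) (@nEq B s).
Proof.
  intros x y h z w k W' i; apply (neq_incl W' i) in h, k.
  change (neq W' s x z <-> neq W' s y w). rewrite h, k; reflexivity.
Qed.

#[global] Instance fequiv_equivalence W : Equivalence (fequiv W).
Proof.
  split; [intros p W' i | intros p q h W' i | intros p q r h k W' i].
  - reflexivity.
  - symmetry; auto.
  - rewrite (h W' i); auto.
Qed.

#[global] Instance and_proper W : Proper (fequiv W ==> fequiv W ==> fequiv W) nAnd.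
Proof. intros p q h p' q' k W' i; cbn; rewrite (h W' i), (k W' i); reflexivity. Qed.

#[global] Instance imp_proper W : Proper (fequiv W ==> fequiv W ==> fequiv W) nImp.
Proof.
  intros p q h p' q' k W' i; cbn. split; intros l W'' j m; apply k; try apply l; auto;
    try apply h; auto; eauto using List.incl_tran.
Qed.

#[global] Instance forces_proper W : Proper (fequiv W ==> iff) (forces W).
Proof. intros p q h; apply h, List.incl_refl. Qed.

Inductive env_eq W : forall D, env B D -> env B D -> Prop :=
| env_eq_nil : env_eq W [] tt tt
| env_eq_cons s D t u (e e' : env B D) :
    neq W s t u -> env_eq W D e e' -> env_eq W (s :: D) (t, e) (u, e').

End Rules.

(** Moves all forced hypotheses to the extended world and forgets the old one, so that a proof sees
    a single current world. *)
Ltac mono W W' i :=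
  repeat match goal with H : forces W _ |- _ => apply (forces_incl _ _ W' i) in H end;
  clear i; try (clear W; rename W' into W).

(* Exposes the conjunctions forced in [T], up to conversion, so that introduction patterns
   need not unfold [forces]. *)
Ltac expose T :=
  lazymatch T with
  | forces ?W (nAnd ?p ?q) =>
      let a := expose constr:(forces W p) in let b := expose constr:(forces W q) in
      constr:(a /\ b)
  | ?a \/ ?b => let a := expose a in let b := expose b in constr:(a \/ b)
  | @ex ?A ?P =>
      let x := fresh in
      constr:(@ex A (fun x : A => ltac:(let p := eval cbv beta in (P x) in
        let r := expose p in exact r)))
  | _ => T
  end.

Ltac expose_premise :=
  cbv beta;
  lazymatch goal with |- ?T -> ?G => let T' := expose T in change (T' -> G) end.

Tactic Notation "iintro" simple_intropattern(p) :=
  lazymatch goal with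
  | |- forces _ (nAll _ _) => lazymatch goal with |- forces ?W (nAll ?s ?f) =>
      refine ((fun h : forall x, forces W (f x) => h) _); cbv beta; intros p end
  | |- forces ?W (nImp _ _) =>
      let W' := fresh "W" in let i := fresh "i" in
      intros W' i; mono W W' i; expose_premise; intros p
  end.

(* Eliminating a disjunction or an existential formula passes to a world of the cover; any forced
   goal may be proved there, by locality. *)
Tactic Notation "idestruct" constr(t) "as" simple_intropattern(p) :=
  let H := fresh in pose proof t as H; cbv beta in H; try (is_var t; clear t);
  lazymatch type of H with
  | forces ?W (nAnd _ _) => revert H; expose_premise; intros p
  | forces ?W _ =>
    (refine (or_e _ H _) || refine (ex_e _ H _)); clear H;
    let W' := fresh "W" in let i := fresh "i" in
    intros W' i; mono W W' i; expose_premise; intros p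
  end.

(* The first parameter is the innermost variable. *)
Definition abs1 {a} (f : tm [a] a -> fm [a]) : fm [a] := f (Var vz).
Definition abs2 {a b} (f : tm [a; b] a -> tm [a; b] b -> fm [a; b]) : fm [a; b] :=
  f (Var vz) (Var (vs vz)).
Definition abs3 {a b c} (f : let G := [a; b; c] in tm G a -> tm G b -> tm G c -> fm G) :
    fm [a; b; c] :=
  f (Var vz) (Var (vs vz)) (Var (vs (vs vz))).
Definition abs4 {a b c d}
    (f : let G := [a; b; c; d] in tm G a -> tm G b -> tm G c -> tm G d -> fm G) :
    fm [a; b; c; d] :=
  f (Var vz) (Var (vs vz)) (Var (vs (vs vz))) (Var (vs (vs (vs vz)))).

Definition abs5 {a b c d e}
    (f : let G := [a; b; c; d; e] in tm G a -> tm G b -> tm G c -> tm G d -> tm G e -> fm G) :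
    fm [a; b; c; d; e] :=
  f (Var vz) (Var (vs vz)) (Var (vs (vs vz))) (Var (vs (vs (vs vz))))
    (Var (vs (vs (vs (vs vz))))).

Ltac iden := cbv beta delta [abs1 abs2 abs3 abs4 abs5]; expand; cbn [den tden look fst snd tm_ren].
Tactic Notation "iden" "in" hyp(H) :=
  revert H; iden; intro H.

Ltac isplit := refine (and_i _ _).
Tactic Notation "iexists" uconstr(t) := refine (ex_i t _); cbv beta.

Ltac iapply T :=
  let P := type of T in let P := eval cbv beta in P in
  lazymatch P with
  | forces ?W (nImp ?p ?q) =>
      first [ exact T
            | let H := fresh in cut (forces W p); [intro H; iapply constr:(imp_e T H) |] ]
  | forces ?W (@nAll ?B ?s ?f) =>
      first [ exact T
            | let x := fresh in evar (x : nt B s); let x' := eval unfold x in x in clear x;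
              iapply constr:(all_e T x') ]
  | _ => first [exact T | exact (ex_falso _ T)]
  end.

Tactic Notation "irewrite" constr(t) :=
  let H := fresh in pose proof t as H; cbv beta in H;
  lazymatch type of H with forces ?W (@nEq _ ?s ?x ?y) => change (neq W s x y) in H; rewrite H end;
    clear H.
Tactic Notation "irewrite" "<-" constr(t) :=
  let H := fresh in pose proof t as H; cbv beta in H;
  lazymatch type of H with forces ?W (@nEq _ ?s ?x ?y) => change (neq W s x y) in H;
    rewrite <- H end; clear H.

(** * Linear arithmetic over the constructive reals *)

Section RealAxioms.
Context {B : ctx} (W : world B).
Implicit Types x y z : nt B Real.

#[local] Notation v0 := (Var vz).
#[local] Notation v1 := (Var (vs vz)).
#[local] Notation v2 := (Var (vs (vs vz))).
#[local] Notation R1 := [Real].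
#[local] Notation R2 := [Real; Real].
#[local] Notation R3 := [Real; Real; Real].

Lemma add_comm x y : W ⊩ x + y = y + x.
Proof. exact (forces_axiom (ax_radd_comm R2 v0 v1) I W (x, (y, tt))). Qed.
Lemma add_assoc x y z : W ⊩ x + (y + z) = (x + y) + z.
Proof. exact (forces_axiom (ax_radd_assoc R3 v0 v1 v2) I W (x, (y, (z, tt)))). Qed.
Lemma add_zero x : W ⊩ x + 0 = x.
Proof. exact (forces_axiom (ax_radd_zero R1 v0) I W (x, tt)). Qed.
Lemma add_opp x : W ⊩ x - x = 0.
Proof. exact (forces_axiom (ax_radd_opp R1 v0) I W (x, tt)). Qed.
Lemma mul_comm x y : W ⊩ x * y = y * x.
Proof. exact (forces_axiom (ax_rmul_comm R2 v0 v1) I W (x, (y, tt))). Qed.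
Lemma mul_assoc x y z : W ⊩ x * (y * z) = (x * y) * z.
Proof. exact (forces_axiom (ax_rmul_assoc R3 v0 v1 v2) I W (x, (y, (z, tt)))). Qed.
Lemma mul_one x : W ⊩ x * 1 = x.
Proof. exact (forces_axiom (ax_rmul_one R1 v0) I W (x, tt)). Qed.
Lemma mul_add x y z : W ⊩ x * (y + z) = x * y + x * z.
Proof. exact (forces_axiom (ax_rmul_radd R3 v0 v1 v2) I W (x, (y, (z, tt)))). Qed.
Lemma inv_ex x : W ⊩ x < 0 ∨ 0 < x -> W ⊩ (∃ y : Real, x * y = 1).
Proof.
  apply imp_e. refine (forces_axiom (ax_rinv R1 v0) _ W (x, tt)).
  cbn; repeat split; exact (Cst c_rzero).
Qed.
Lemma lt_zero_one : W ⊩ 0 < 1.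
Proof. exact (forces_axiom (ax_rlt_zero_one []) I W tt). Qed.
Lemma lt_asym x y : W ⊩ x < y -> W ⊩ y < x -> W ⊩ ⊥.
Proof.
  intros h k; refine (imp_e (imp_e _ h) k).
  apply (forces_axiom (ax_rlt_asym R2 v0 v1)) with (e := (x, (y, tt))); cbn; tauto.
Qed.
Lemma lt_cotrans x y z : W ⊩ x < y -> W ⊩ x < z ∨ z < y.
Proof.
  intros h; refine (imp_e _ h).
  apply (forces_axiom (ax_rlt_cotrans R3 v0 v1 v2)) with (e := (x, (y, (z, tt)))); cbn; tauto.
Qed.
Lemma lt_tight x y : W ⊩ y <= x -> W ⊩ x <= y -> W ⊩ x = y.
Proof.
  intros h k; refine (imp_e (imp_e _ h) k).
  apply (forces_axiom (ax_rlt_tight R2 v0 v1)) with (e := (x, (y, tt))); cbn; tauto.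
Qed.
Lemma lt_add x y z : W ⊩ x < y -> W ⊩ x + z < y + z.
Proof.
  intros h; refine (imp_e _ h).
  apply (forces_axiom (ax_rlt_radd R3 v0 v1 v2)) with (e := (x, (y, (z, tt)))); cbn; tauto.
Qed.
Lemma lt_mul x y : W ⊩ 0 < x -> W ⊩ 0 < y -> W ⊩ 0 < x * y.
Proof.
  intros h k; refine (imp_e (imp_e _ h) k).
  apply (forces_axiom (ax_rlt_rmul R2 v0 v1)) with (e := (x, (y, tt))); cbn; tauto.
Qed.
Lemma max_l x y : W ⊩ x <= rmaxn x y.
Proof.
  apply (forces_axiom (ax_rmax_l R2 v0 v1)) with (e := (x, (y, tt))); cbn; tauto.
Qed.
Lemma max_r x y : W ⊩ y <= rmaxn x y.
Proof.
  apply (forces_axiom (ax_rmax_r R2 v0 v1)) with (e := (x, (y, tt))); cbn; tauto.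
Qed.
Lemma max_lub x y z : W ⊩ z < rmaxn x y -> W ⊩ z < x ∨ z < y.
Proof.
  intros h; refine (imp_e _ h).
  apply (forces_axiom (ax_rmax_lub R3 v0 v1 v2)) with (e := (x, (y, (z, tt)))); cbn; tauto.
Qed.

End RealAxioms.

(** * Ring identities by reflection *)

Section Arith.
Context {B : ctx}.
Implicit Types W : world B.
Implicit Types x y z : nt B Real.

#[local] Notation Radd := (fun x y : nt B Real => (x + y)%nt).
#[local] Notation Rmul := (fun x y : nt B Real => (x * y)%nt).
#[local] Notation Rsub := (fun x y : nt B Real => (x - y)%nt).
#[local] Notation Ropp := (fun x : nt B Real => (- x)%nt).

Lemma real_ring W : ring_theory 0%nt 1%nt Radd Rmul Rsub Ropp (neq W Real).
Proof.
  constructor; intros.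
  - rewrite (add_comm W 0 x : neq W _ _ _). apply add_zero.
  - apply add_comm.
  - apply add_assoc.
  - rewrite (mul_comm W 1 x : neq W _ _ _). apply mul_one.
  - apply mul_comm.
  - apply mul_assoc.
  - rewrite (mul_comm W (x + y) z : neq W _ _ _), (mul_comm W x z : neq W _ _ _),
      (mul_comm W y z : neq W _ _ _). apply mul_add.
  - reflexivity.
  - apply add_opp.
Qed.

Lemma real_ring_ext W : ring_eq_ext Radd Rmul Ropp (neq W Real).
Proof. constructor; repeat intro; cbv beta; repeat apply app_proper; assumption || reflexivity. Qed.

Definition zden : Z -> nt B Real := gen_phiZ 0%nt 1%nt Radd Rmul Ropp.
Definition pden (l : list (nt B Real)) (p : PExpr Z) : nt B Real :=
  PEeval 0%nt 1%nt Radd Rmul Rsub Ropp zden id_phi_N (pow_N 1%nt Rmul) l p.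

Definition pnorm (p : PExpr Z) : Pol Z :=
  norm_subst 0%Z 1%Z Z.add Z.mul Z.sub Z.opp Z.eqb (triv_div 0%Z 1%Z Z.eqb) 0 [] p.

(** The ring normaliser of the library is correct for every setoid ring; here the setoid is that of
    names modulo equality forced in [W]. *)
Lemma pden_eq W l p q : Peq Z.eqb (pnorm p) (pnorm q) = true -> neq W _ (pden l p) (pden l q).
Proof.
  intro h. pose proof (real_ring_ext W) as E. pose proof (real_ring W) as R.
  pose proof (gen_phiZ_morph (neq_equivalence W Real) E R) as M.
  pose proof (Rth_ARth (neq_equivalence W Real) E R) as AR.
  exact (ring_correct (neq_equivalence W Real) E AR M (pow_N_th _ _ (neq_equivalence W Real))
    (triv_div_th (neq_equivalence W Real) E AR M) 0 l [] p q I h).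
Qed.

Lemma ring_eq W l p q x y : pden l p = x -> pden l q = y ->
  Peq Z.eqb (pnorm p) (pnorm q) = true -> W ⊩ x = y.
Proof. intros <- <-; apply pden_eq. Qed.

End Arith.

Ltac real_mem x l :=
  lazymatch l with
  | nil => constr:(false)
  | x :: _ => constr:(true)
  | _ :: ?l => real_mem x l
  end.

Ltac real_atoms l t :=
  lazymatch t with
  | NC c_rzero => l
  | NC c_rone => l
  | NA (NA (NC c_radd) ?x) ?y => let l := real_atoms l x in real_atoms l y
  | NA (NA (NC c_rmul) ?x) ?y => let l := real_atoms l x in real_atoms l y
  | NA (NC c_ropp) ?x => real_atoms l x
  | _ => lazymatch real_mem t l with true => l | false => constr:(t :: l) end
  end.

Ltac real_index t l :=
  lazymatch l with
  | t :: _ => constr:(1%positive)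
  | _ :: ?l => let i := real_index t l in eval vm_compute in (Pos.succ i)
  end.

Ltac real_reify l t :=
  lazymatch t with
  | NC c_rzero => constr:(@PEO Z)
  | NC c_rone => constr:(@PEI Z)
  | NA (NA (NC c_radd) ?x) ?y =>
      let p := real_reify l x in let q := real_reify l y in constr:(PEadd p q)
  | NA (NA (NC c_rmul) ?x) ?y =>
      let p := real_reify l x in let q := real_reify l y in constr:(PEmul p q)
  | NA (NC c_ropp) ?x => let p := real_reify l x in constr:(PEopp p)
  | _ => let i := real_index t l in constr:(PEX Z i)
  end.

Ltac iring :=
  lazymatch goal with
  | |- forces ?W (@nEq ?B _ ?x ?y) =>
      let l := real_atoms (@nil (nt B Real)) x in
      let l := real_atoms l y in
      let p := real_reify l x in
      let q := real_reify l y in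
      apply (ring_eq W l p q x y); [reflexivity | reflexivity | vm_compute; reflexivity]
  end.

Lemma lt_eq {B} {W : world B} {x y : nt B Real} x' y' :
  W ⊩ x' < y' -> W ⊩ x = x' -> W ⊩ y = y' -> W ⊩ x < y.
Proof. intros h e e'. irewrite e. irewrite e'. exact h. Qed.

(** * Order and certificates for linear inequalities *)

Section Order.
Context {B : ctx}.
Implicit Types W : world B.
Implicit Types x y z a b : nt B Real.

Lemma lt_irrefl {W x} : W ⊩ x < x -> W ⊩ ⊥.
Proof. intro h; exact (lt_asym W x x h h). Qed.

Lemma lt_sub {W x y} : W ⊩ x < y -> W ⊩ 0 < y - x.
Proof. intro h. apply (lt_eq (x - x) (y - x)); [now apply lt_add | iring | iring]. Qed.

Lemma sub_lt {W x y} : W ⊩ 0 < y - x -> W ⊩ x < y.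
Proof. intro h. apply (lt_eq (0 + x) ((y - x) + x)); [now apply lt_add | iring | iring]. Qed.

(** Since b < a + b, cotransitivity at 0 gives b < 0, which is excluded, or the claim. *)
Lemma pos_nonneg_add {W a b} : W ⊩ 0 < a -> W ⊩ 0 <= b -> W ⊩ 0 < a + b.
Proof.
  intros h k. assert (l : W ⊩ b < a + b).
  { apply (lt_eq (0 + b) (a + b)); [now apply lt_add | iring | iring]. }
  idestruct (lt_cotrans W b (a + b) 0 l) as [m|m]; auto. iapply k; auto.
Qed.

Lemma add_pos_cases {W a b} : W ⊩ 0 < a + b -> W ⊩ 0 < a ∨ 0 < b.
Proof.
  intros h. idestruct (lt_cotrans W 0 (a + b) b h) as [m|m]; [now apply or_r | apply or_l].
  apply lt_sub in m. apply (lt_eq 0 (a + b - b)); auto; iring.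
Qed.

Lemma neg_lt {W a} : W ⊩ a < 0 -> W ⊩ 0 < - a.
Proof. intro h. apply lt_sub in h. apply (lt_eq 0 (0 - a)); auto; iring. Qed.

Lemma nonneg_of_not_neg {W a} : W ⊩ (0 < - a → ⊥) -> W ⊩ 0 <= a.
Proof. intros h. iintro k. iapply h. now apply neg_lt. Qed.

Lemma nonneg_add {W a b} : W ⊩ 0 <= a -> W ⊩ 0 <= b -> W ⊩ 0 <= a + b.
Proof.
  intros h k. apply nonneg_of_not_neg. iintro l. assert (m : W ⊩ 0 < (- a) + (- b)).
  { apply (lt_eq 0 (- (a + b))); auto; iring. }
  idestruct (add_pos_cases m) as [n|n]; [iapply h | iapply k]; apply sub_lt;
    [apply (lt_eq 0 (- a)) | apply (lt_eq 0 (- b))]; auto; iring.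
Qed.

Lemma le_sub {W x y} : W ⊩ x <= y -> W ⊩ 0 <= y - x.
Proof.
  intro h. apply nonneg_of_not_neg. iintro k. iapply h. apply sub_lt.
  apply (lt_eq 0 (- (y - x))); auto; iring.
Qed.

Lemma sub_le {W x y} : W ⊩ 0 <= y - x -> W ⊩ x <= y.
Proof.
  intro h. iintro k. iapply h. apply lt_sub in k. apply sub_lt.
  apply (lt_eq 0 (x - y)); auto; iring.
Qed.

Lemma le_eq {W x y} x' y' : W ⊩ x' <= y' -> W ⊩ x = x' -> W ⊩ y = y' -> W ⊩ x <= y.
Proof. intros h e e'. iintro k. iapply h. irewrite <- e. irewrite <- e'. exact k. Qed.

Lemma le_refl {W x} : W ⊩ x <= x.
Proof. iintro h. exact (lt_irrefl h). Qed.

Lemma lt_le {W x y} : W ⊩ x < y -> W ⊩ x <= y.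
Proof. intro h. iintro k. exact (lt_asym _ _ _ h k). Qed.

Lemma zden_succ {W} p : W ⊩ zden (Z.pos (Pos.succ p)) = zden (Z.pos p) + 1.
Proof.
  rewrite <- Pos.add_1_r. change (Z.pos (p + 1)) with (Z.pos p + 1)%Z.
  exact (morph_add (gen_phiZ_morph (neq_equivalence W Real) (real_ring_ext W) (real_ring W)) _ _).
Qed.

Lemma zden_succ_mul {W} p a :
  W ⊩ zden (Z.pos (Pos.succ p)) * a = zden (Z.pos p) * a + a.
Proof. irewrite (@zden_succ W p). iring. Qed.

Lemma zden_mul_pos {W a} p : W ⊩ 0 < a -> W ⊩ 0 < zden (Z.pos p) * a.
Proof.
  intro h. induction p as [|p IH] using Pos.peano_ind.
  - apply (lt_eq 0 a); auto; cbv [zden gen_phiZ gen_phiPOS]; iring.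
  - apply (lt_eq 0 (zden (Z.pos p) * a + a)); [|iring|apply zden_succ_mul].
    apply pos_nonneg_add; auto using lt_le.
Qed.

Lemma zden_mul_nonneg {W a} p : W ⊩ 0 <= a -> W ⊩ 0 <= zden (Z.pos p) * a.
Proof.
  intro h. induction p as [|p IH] using Pos.peano_ind.
  - apply (le_eq 0 a); auto; cbv [zden gen_phiZ gen_phiPOS]; iring.
  - apply (le_eq 0 (zden (Z.pos p) * a + a)); [|iring|apply zden_succ_mul].
    now apply nonneg_add.
Qed.

(** A positive sum has a positive summand, by cotransitivity, and p a is a sum of copies of a; no
    division enters. *)
Lemma zden_pos_cancel p : forall W a, W ⊩ 0 < zden (Z.pos p) * a -> W ⊩ 0 < a.
Proof.
  induction p as [|p IH] using Pos.peano_ind; intros W a h.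
  - apply (lt_eq 0 (zden 1 * a)); auto; cbv [zden gen_phiZ gen_phiPOS]; iring.
  - assert (k : W ⊩ 0 < zden (Z.pos p) * a + a).
    { apply (lt_eq _ _ h); [iring|]. apply ieq_sym, zden_succ_mul. }
    idestruct (add_pos_cases k) as [l|l]; auto.
Qed.

Lemma zden_nonneg_cancel W a p : W ⊩ 0 <= zden (Z.pos p) * a -> W ⊩ 0 <= a.
Proof.
  intro h. apply nonneg_of_not_neg. iintro k. iapply h.
  apply (zden_mul_pos p) in k. apply sub_lt. apply (lt_eq _ _ k); iring.
Qed.

Inductive rel := Req | Rle | Rlt.

Definition holds W (l : list (nt B Real)) (c : rel * PExpr Z) : Prop :=
  match fst c with
  | Req => W ⊩ 0 = pden l (snd c)
  | Rle => W ⊩ 0 <= pden l (snd c)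
  | Rlt => W ⊩ 0 < pden l (snd c)
  end.

Fixpoint combination (cs : list (rel * PExpr Z)) (ks : list Z) : PExpr Z :=
  match cs, ks with
  | (_, p) :: cs, k :: ks => PEadd (PEmul (PEc k) p) (combination cs ks)
  | _, _ => PEO
  end.

Fixpoint admissible (cs : list (rel * PExpr Z)) (ks : list Z) : bool :=
  match cs, ks with
  | (Req, _) :: cs, _ :: ks => admissible cs ks
  | (_, _) :: cs, k :: ks => (0 <=? k)%Z && admissible cs ks
  | _, _ => true
  end.

Fixpoint strict (cs : list (rel * PExpr Z)) (ks : list Z) : bool :=
  match cs, ks with
  | (Rlt, _) :: cs, k :: ks => (0 <? k)%Z || strict cs ks
  | _ :: cs, _ :: ks => strict cs ks
  | _, _ => false
  end.

Lemma combination_sound {W l cs} : Forall (holds W l) cs -> forall ks, admissible cs ks = true ->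
  (W ⊩ 0 <= pden l (combination cs ks)) /\
  (strict cs ks = true -> W ⊩ 0 < pden l (combination cs ks)).
Proof.
  induction 1 as [|[r p] cs h hs IH]; intros [|k ks] ad; try (split;
    [apply le_refl | discriminate]).
  { destruct r; split; try discriminate; apply le_refl. }
  set (q := combination cs ks).
  assert (E : forall k, pden l (PEadd (PEmul (PEc k) p) q) = (zden k * pden l p + pden l q)%nt)
    by reflexivity.
  cbn [combination]; fold q; rewrite E.
  destruct r; cbn [holds admissible strict fst snd] in ad, h |- *.
  - destruct (IH ks ad) as [n s]. fold q in n, s.
    assert (z : W ⊩ zden k * pden l p + pden l q = pden l q).
    { irewrite <- h. iring. }
    split; [|intro t]; [apply (le_eq _ _ n) | apply (lt_eq _ _ (s t))]; auto; iring.
  - apply andb_prop in ad as [ad1 ad]. destruct (IH ks ad) as [n s]. fold q in n, s.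
    assert (m : W ⊩ 0 <= zden k * pden l p).
    { destruct k as [|k|k]; [|now apply zden_mul_nonneg | discriminate].
      apply (le_eq 0 0 le_refl); cbv [zden gen_phiZ gen_phiPOS]; iring. }
    split; [now apply nonneg_add|]. intro t. specialize (s t).
    apply (lt_eq 0 (pden l q + zden k * pden l p)); [now apply pos_nonneg_add | iring | iring].
  - apply andb_prop in ad as [ad1 ad]. destruct (IH ks ad) as [n s]. fold q in n, s.
    destruct k as [|k|k]; [| |discriminate].
    + assert (z : W ⊩ zden 0 * pden l p + pden l q = pden l q) by (cbv [zden gen_phiZ gen_phiPOS];
        iring).
      split; [|intro t]; [apply (le_eq _ _ n) | apply (lt_eq _ _ (s t))]; auto; iring.
    + assert (m : W ⊩ 0 < zden (Z.pos k) * pden l p + pden l q).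
      { apply pos_nonneg_add; auto. now apply zden_mul_pos. }
      split; auto using lt_le.
Qed.

(* A certificate for [0 < g] (or [0 <= g]) is a nonnegative integer [k] such that [k * g] is a
   combination of the hypotheses; [k = 0] means that the hypotheses are contradictory. *)
Definition certifies (st : bool) (g : PExpr Z) (cs : list (rel * PExpr Z)) (k : Z) (ks : list Z) :
    bool :=
  let s := strict cs ks in
  admissible cs ks && (0 <=? k)%Z && (if st then s else (0 <? k)%Z || s) &&
  Peq Z.eqb (pnorm (PEmul (PEc k) g)) (pnorm (combination cs ks)).

Lemma certifies_lt {W l cs g} k ks : Forall (holds W l) cs -> certifies true g cs k ks = true ->
  W ⊩ 0 < pden l g.
Proof.
  intros h c. unfold certifies in c. apply andb_prop in c as [c e].
  apply andb_prop in c as [c s]. apply andb_prop in c as [c k0].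
  destruct (combination_sound h ks c) as [_ p]. specialize (p s).
  apply (pden_eq W l) in e. change (W ⊩ zden k * pden l g = pden l (combination cs ks)) in e.
  assert (q : W ⊩ 0 < zden k * pden l g) by (apply (lt_eq _ _ p); auto; iring).
  destruct k as [|k|k]; [|now apply zden_pos_cancel in q | discriminate].
  apply ex_falso, (@lt_irrefl W 0), (lt_eq _ _ q); cbv [zden gen_phiZ gen_phiPOS]; iring.
Qed.

Lemma certifies_le {W l cs g} k ks : Forall (holds W l) cs -> certifies false g cs k ks = true ->
  W ⊩ 0 <= pden l g.
Proof.
  intros h c. pose proof c as c'. unfold certifies in c. apply andb_prop in c as [c e].
  apply andb_prop in c as [c s]. apply andb_prop in c as [c k0].
  destruct (strict cs ks) eqn:t.
  - apply lt_le. apply (certifies_lt k ks h). unfold certifies in *; rewrite t in *.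
    cbn in *. rewrite orb_true_r in c'. exact c'.
  - rewrite orb_false_r in s. destruct (combination_sound h ks c) as [p _].
    apply (pden_eq W l) in e. change (W ⊩ zden k * pden l g = pden l (combination cs ks)) in e.
    assert (q : W ⊩ 0 <= zden k * pden l g) by (apply (le_eq _ _ p); auto; iring).
    destruct k as [|k|k]; [discriminate | now apply zden_nonneg_cancel in q | discriminate].
Qed.

Lemma holds_lt {W l p q} : W ⊩ pden l p < pden l q -> holds W l (Rlt, PEsub q p).
Proof. exact lt_sub. Qed.
Lemma holds_le {W l p q} : W ⊩ pden l p <= pden l q -> holds W l (Rle, PEsub q p).
Proof. exact le_sub. Qed.
Lemma holds_eq {W l p q} : W ⊩ pden l p = pden l q -> holds W l (Req, PEsub q p).
Proof.
  intro h. change (W ⊩ 0 = pden l q - pden l p). irewrite h. iring.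
Qed.
Lemma linear_lt {W l cs p q x y} k ks : pden l p = x -> pden l q = y -> Forall (holds W l) cs ->
  certifies true (PEsub q p) cs k ks = true -> W ⊩ x < y.
Proof. intros <- <- h c. apply sub_lt. exact (certifies_lt k ks h c). Qed.

Lemma linear_le {W l cs p q x y} k ks : pden l p = x -> pden l q = y -> Forall (holds W l) cs ->
  certifies false (PEsub q p) cs k ks = true -> W ⊩ x <= y.
Proof. intros <- <- h c. apply sub_le. exact (certifies_le k ks h c). Qed.

Lemma eq_of_le {W x y} : W ⊩ x <= y -> W ⊩ y <= x -> W ⊩ x = y.
Proof. intros; now apply lt_tight. Qed.

End Order.

(* Fourier-Motzkin elimination finds the certificates; only their check is verified. *)
Definition lin : Type := list (list positive * Z).

Fixpoint mono_compare (m n : list positive) : comparison :=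
  match m, n with
  | [], [] => Datatypes.Eq
  | [], _ => Datatypes.Lt
  | _, [] => Datatypes.Gt
  | i :: m, j :: n => match Pos.compare i j with Datatypes.Eq => mono_compare m n | c => c end
  end.

Fixpoint insert_var (i : positive) (m : list positive) : list positive :=
  match m with
  | [] => [i]
  | j :: m' => if Pos.leb i j then i :: m else j :: insert_var i m'
  end.

Fixpoint lin_add_mono (c : list positive * Z) (l : lin) : lin :=
  let (m, k) := c in
  if Z.eqb k 0 then l else
  match l with
  | [] => [c]
  | (m', k') :: l' =>
      match mono_compare m m' with
      | Datatypes.Eq => if Z.eqb (k + k') 0 then l' else (m, (k + k')%Z) :: l'
      | Datatypes.Lt => c :: l
      | Datatypes.Gt => (m', k') :: lin_add_mono c l'
      end
  end.

Definition lin_add (l l' : lin) : lin := fold_right lin_add_mono l' l.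
Definition lin_scale (k : Z) (l : lin) : lin :=
  if Z.eqb k 0 then [] else map (fun c => (fst c, (k * snd c)%Z)) l.
Definition lin_mul (l l' : lin) : lin :=
  fold_right (fun c acc => fold_right (fun c' =>
    lin_add_mono (fold_right insert_var (fst c') (fst c), (snd c * snd c')%Z)) acc l') [] l.

Fixpoint lin_of (p : PExpr Z) : lin :=
  match p with
  | PEO => []
  | PEI => [([], 1%Z)]
  | PEc k => lin_add_mono ([], k) []
  | PEX _ i => [([i], 1%Z)]
  | PEadd p q => lin_add (lin_of p) (lin_of q)
  | PEsub p q => lin_add (lin_of p) (lin_scale (-1) (lin_of q))
  | PEmul p q => lin_mul (lin_of p) (lin_of q)
  | PEopp p => lin_scale (-1) (lin_of p)
  | PEpow _ _ => []
  end.

(* The last component expresses the constraint as a combination of the given ones. *)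
Definition constraint : Type := rel * lin * list Z.

Fixpoint coefficient (m : list positive) (l : lin) : Z :=
  match l with
  | [] => 0%Z
  | (m', k) :: l => match mono_compare m m' with Datatypes.Eq => k | _ => coefficient m l end
  end.

Fixpoint zip_add (k : Z) (u v : list Z) : list Z :=
  match u, v with
  | a :: u, b :: v => (k * a + b)%Z :: zip_add k u v
  | [], v => v
  | u, [] => map (Z.mul k) u
  end.

Definition combine_constraints (k : Z) (c : constraint) (k' : Z) (c' : constraint) : constraint :=
  let '(r, l, u) := c in
  let '(r', l', u') := c' in
  (match r, r' with Rlt, _ | _, Rlt => Rlt | Rle, _ | _, Rle => Rle | _, _ => Req end,
   lin_add (lin_scale k l) (lin_scale k' l'), zip_add k u (map (Z.mul k') u')).

Definition constraint_coefficient (m : list positive) (c : constraint) : Z :=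
  coefficient m (snd (fst c)).
Definition is_equation (c : constraint) : bool :=
  match fst (fst c) with Req => true | _ => false end.

(** Each monomial counts as an independent unknown. An equation containing [m] is substituted
    everywhere, with positive multiplier [Z.abs k] on the other constraint so that inequalities keep
    their direction; without one, inequalities of opposite sign in [m] are paired. *)
Definition eliminate (m : list positive) (cs : list constraint) : list constraint :=
  let z := filter (fun c => Z.eqb (constraint_coefficient m c) 0) cs in
  let nz := filter (fun c => negb (Z.eqb (constraint_coefficient m c) 0)) cs in
  match filter is_equation nz with
  | e :: _ =>
      let k := constraint_coefficient m e in
      map (fun c => combine_constraints (Z.abs k) c
             (- Z.sgn k * constraint_coefficient m c) e) nz ++ z
  | [] =>
      let pos := filter (fun c => Z.ltb 0 (constraint_coefficient m c)) nz in
      let neg := filter (fun c => Z.ltb (constraint_coefficient m c) 0) nz in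
      flat_map (fun c => map (fun c' =>
        combine_constraints (- constraint_coefficient m c') c (constraint_coefficient m c) c') neg)
        pos ++ z
  end.

Definition elimination_cost (m : list positive) (cs : list constraint) : nat :=
  let nz := filter (fun c => negb (Z.eqb (constraint_coefficient m c) 0)) cs in
  match filter is_equation nz with
  | _ :: _ => O
  | [] =>
      let p := length (filter (fun c => Z.ltb 0 (constraint_coefficient m c)) nz) in
      p * (length nz - p)
  end.

Definition contradictory (c : constraint) : bool :=
  match c with
  | (Rlt, [], _) => true
  | (Rlt, [([], k)], _) | (Rle, [([], k)], _) => Z.ltb k 0
  | (Req, [([], _)], _) => true
  | _ => false
  end.

Definition is_constant (c : constraint) : bool :=
  match snd (fst c) with [] | [([], _)] => true | _ => false end.

Fixpoint refute (fuel : nat) (cs : list constraint) : option (lin * list Z) :=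
  match find contradictory cs with
  | Some (_, l, u) => Some (l, u)
  | None =>
      match fuel with
      | O => None
      | S fuel =>
          let cs := filter (fun c => negb (is_constant c)) cs in
          let ms := filter (fun m => match m with [] => false | _ => true end)
            (flat_map (fun c => map fst (snd (fst c))) cs) in
          match ms with
          | [] => None
          | m :: ms =>
              let best := fold_right (fun m b =>
                if Nat.ltb (elimination_cost m cs) (elimination_cost b cs) then m else b) m ms in
              refute fuel (eliminate best cs)
          end
      end
  end.

Fixpoint number_constraints (i n : nat) (cs : list (rel * PExpr Z)) : list constraint :=
  match cs with
  | [] => []
  | (r, p) :: cs =>
      (r, lin_of p, repeat 0%Z i ++ [1%Z] ++ repeat 0%Z (n - S i)) :: number_constraints (S i) n cs
  end.

(* The first of [cs] is [0 < 1], and the negated goal is put in front. *)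
Definition find_certificate (st : bool) (g : PExpr Z) (cs : list (rel * PExpr Z)) : Z * list Z :=
  let cs' := ((if st then Rle else Rlt), PEopp g) :: cs in
  match refute 50 (number_constraints 0 (length cs') cs') with
  | Some (l, k :: one :: ks) =>
      (* The refutation reads k (-g) + one + ... = c, hence k g = (one - c) + ...; a contradictory
         equation may require all signs to be reversed. *)
      let c := coefficient [] l in
      if Z.ltb (one - c) 0 then ((-k)%Z, (c - one)%Z :: map Z.opp ks) else (k, (one - c)%Z :: ks)
  | _ => (0%Z, [])
  end.

Ltac collect_hyps W done :=
  match goal with
  | H : forces W ?P |- _ =>
      let ok := lazymatch done with context [H] => fail | _ => constr:(tt) end in
      let ok := lazymatch P with
        | nLt _ _ => ok | nImp (nLt _ _) nBot => ok | @nEq _ Real _ _ => ok end in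
      collect_hyps W constr:((H, done))
  | _ => done
  end.

Ltac atoms_of_hyps l hs :=
  lazymatch hs with
  | (?H, ?hs) =>
      let l := lazymatch type of H with
        | forces _ (nLt ?x ?y) => let l := real_atoms l x in real_atoms l y
        | forces _ (nImp (nLt ?x ?y) nBot) => let l := real_atoms l x in real_atoms l y
        | forces _ (nEq ?x ?y) => let l := real_atoms l x in real_atoms l y
        end in
      atoms_of_hyps l hs
  | _ => l
  end.

Ltac reify_hyps W l hs :=
  lazymatch hs with
  | (?H, ?hs) =>
      let t := reify_hyps W l hs in
      lazymatch type of H with
      | forces _ (nLt ?x ?y) =>
          let p := real_reify l x in let q := real_reify l y in
          constr:(Forall_cons (Rlt, PEsub q p) (@holds_lt _ W l p q H) t)
      | forces _ (nImp (nLt ?y ?x) nBot) =>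
          let p := real_reify l x in let q := real_reify l y in
          constr:(Forall_cons (Rle, PEsub q p) (@holds_le _ W l p q H) t)
      | forces _ (nEq ?x ?y) =>
          let p := real_reify l x in let q := real_reify l y in
          constr:(Forall_cons (Req, PEsub q p) (@holds_eq _ W l p q H) t)
      end
  | _ => constr:(Forall_nil (holds W l))
  end.

Ltac linear_goal W x y st :=
  lazymatch type of x with nt ?B _ =>
      let hs := collect_hyps W tt in
      let l := real_atoms (@nil (nt B Real)) x in
      let l := real_atoms l y in
      let l := atoms_of_hyps l hs in
      let p := real_reify l x in
      let q := real_reify l y in
      let h := reify_hyps W l hs in
      let h := constr:(Forall_cons (Rlt, PEI) (@lt_zero_one _ W) h) in
      lazymatch type of h with Forall _ ?cs =>
        let c := eval vm_compute in (find_certificate st (PEsub q p) cs) in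
        lazymatch c with
        | (?k, ?ks) =>
          lazymatch st with
          | true => refine (@linear_lt _ W l cs p q x y k ks eq_refl eq_refl h _)
          | false => refine (@linear_le _ W l cs p q x y k ks eq_refl eq_refl h _)
          end; vm_compute; reflexivity
        end
      end
  end.

(** An equation is split into two inequalities; a goal that is no comparison is reached through
    absurdity, by deriving 0 < 0. *)
Ltac ilra :=
  lazymatch goal with
  | |- forces ?W (nLt ?x ?y) => linear_goal W x y true
  | |- forces ?W (nImp (nLt ?y ?x) nBot) => linear_goal W x y false
  | |- forces ?W (@nEq ?B Real ?x ?y) => apply eq_of_le; ilra
  | |- forces ?W ?p => apply ex_falso; apply (@lt_irrefl _ _ 0%nt); ilra
  end.

(** * Induction, choice and comprehension *)

(** Such a term supplies the default of the names of the sort; instance search settles the side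
    conditions [okf]. *)
Class Inh (B : ctx) (s : sort) : Prop := inh : inhabited (tm B s).
#[global] Instance inh_nat B : Inh B Nat := inhabits (Cst c_zero).
#[global] Instance inh_real B : Inh B Real := inhabits (Cst c_rzero).
#[global] Instance inh_nat_real B : Inh B (Fun Nat Real) := inhabits (Cst c_ofnat).
#[global] Instance inh_interval_real B : Inh B (Fun Interval Real) := inhabits (Cst c_incl).
#[global] Instance inh_prod B a b : Inh B a -> Inh B b -> Inh B (Prod a b).
Proof. intros [t] [u]; exact (inhabits (App (App (Cst (c_pair a b)) t) u)). Qed.

Lemma okf_sub {B D} (p : fm D) : forall F (f : substitution D F),
  @okf B _ p -> @okf B _ (fm_sub f p).
Proof. induction p; cbn; intros F f h; try destruct h; auto. Qed.

Ltac iok :=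
  first [ assumption | solve [apply okf_sub; assumption] | hnf ];
  lazymatch goal with
  | |- _ /\ _ => split; iok
  | |- True => exact I
  | |- inhabited (tm ?B ?s) => exact (@inh B s _)
  | _ => idtac
  end.

Section Schemas.
Context {B : ctx}.
Implicit Types W : world B.

Lemma look_eq {W D} {e e' : env B D} : env_eq W D e e' ->
  forall s (v : var D s), neq W s (look v e) (look v e').
Proof.
  induction 1 as [|s D t u e e' h k IH]; [intros s v; inversion v|].
  apply var_cons_ind; cbn; auto.
Qed.

Lemma tden_eq {W D} {e e' : env B D} : env_eq W D e e' ->
  forall s (t : tm D s), neq W s (tden t e) (tden t e').
Proof.
  intros h s t; induction t; cbn [tden];
    [now apply look_eq | apply ieq_refl | now apply app_proper].
Qed.

Lemma env_eq_incl {W D} {e e' : env B D} : env_eq W D e e' ->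
  forall W', List.incl W W' -> env_eq W' D e e'.
Proof. induction 1; constructor; eauto using neq_incl. Qed.

Lemma env_eq_refl W D (e : env B D) : env_eq W D e e.
Proof.
  induction D; destruct e; constructor; [apply ieq_refl | auto].
Qed.

Lemma forces_env_eq {D} (p : fm D) : forall W (e e' : env B D), env_eq W D e e' ->
  W ⊩ den p e <-> W ⊩ den p e'.
Proof.
  induction p; intros W e e' h; cbn [den].
  - reflexivity.
  - apply forces_proper, eq_proper; now apply tden_eq.
  - apply forces_proper, lt_proper; now apply tden_eq.
  - apply forces_proper, and_proper; intros W' i; eauto using env_eq_incl.
  - cbn; apply cover_iff; intros W' i; rewrite (IHp1 W' e e'), (IHp2 W' e e');
      eauto using env_eq_incl; reflexivity.
  - apply forces_proper, imp_proper; intros W' i; eauto using env_eq_incl.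
  - cbn; split; intros k x;
      apply (IHp W (x, e) (x, e') (env_eq_cons W _ _ _ _ _ _ ieq_refl h)); auto.
  - cbn; apply cover_iff; intros W' i; apply (env_eq_incl h W') in i;
      split; intros [x m]; exists x;
      apply (IHp W' (x, e) (x, e') (env_eq_cons W' _ _ _ _ _ _ ieq_refl i)); auto.
Qed.

Lemma sub1_den {W D F a} {x : ext D F} (p : fm (a :: D)) (t : tm F a) (e' : env B F) (e : env B D) :
  (forall s v, look (emb s v) e' = look v e) ->
  W ⊩ den (sub1 p t) e' <-> W ⊩ @den B (a :: D) p (tden t e', e).
Proof. intro h; apply forces_sub. apply var_cons_ind; auto. Qed.

Lemma sub2_den {W D F a b} {x : ext D F} (p : fm (b :: a :: D)) (t : tm F a) (u : tm F b)
    (e' : env B F) (e : env B D) :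
  (forall s v, look (emb s v) e' = look v e) ->
  W ⊩ den (sub2 p t u) e' <-> W ⊩ @den B (b :: a :: D) p (tden u e', (tden t e', e)).
Proof.
  intro h; apply forces_sub. apply var_cons_ind; [|apply var_cons_ind]; auto.
Qed.

Lemma induction {D} (p : fm (Nat :: D)) (e : env B D) W : @okf B _ p ->
  W ⊩ @den B (Nat :: D) p (zeron, e) ->
  W ⊩ (∀ n : Nat, @den B (Nat :: D) p (n, e) → @den B (Nat :: D) p (succn n, e)) ->
  W ⊩ (∀ n : Nat, @den B (Nat :: D) p (n, e)).
Proof.
  intros ok h0 hs. iintro n.
  assert (ax := @forces_axiom B D _ (ax_induction D p)).
  specialize (ax ltac:(iok) W e).
  apply (sub1_den (F := Nat :: D) p (Var vz) (n, e) e); [reflexivity|].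
  refine (all_e (imp_e (imp_e ax _) _) n).
  - now apply (sub1_den p _ e e).
  - iintro k. iintro l. apply (sub1_den (F := Nat :: D) p _ (k, e) e); [reflexivity|].
    iapply (all_e hs k). apply (sub1_den (F := Nat :: D) p _ (k, e) e) in l; auto.
Qed.

Lemma dependent_choice {D a} (p : fm (a :: D)) (q : fm (a :: a :: D)) (e : env B D) W x0 :
  Inh B a -> Inh B (Fun Nat a) -> @okf B _ p -> @okf B _ q ->
  W ⊩ (∀ x : a, @den B (a :: D) p (x, e) →
        ∃ y : a, @den B (a :: D) p (y, e) ∧ @den B (a :: a :: D) q (y, (x, e))) ->
  W ⊩ @den B (a :: D) p (x0, e) ->
  W ⊩ (∃ f : Fun Nat a, f @ zeron = x0 ∧ ∀ n : Nat, @den B (a :: D) p (f @ n, e) ∧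
        @den B (a :: a :: D) q (f @ succn n, (f @ n, e))).
Proof.
  intros ia ifa okp okq h h0.
  assert (ax := @forces_axiom B D _ (ax_dependent_choice D a p q)).
  specialize (ax ltac:(iok) W e).
  assert (L : W ⊩ (∃ f : Fun Nat a, f @ zeron = x0 ∧ ∀ n : Nat,
    @den B (Nat :: Fun Nat a :: a :: D) (sub1 p (App (Var (vs vz)) (Var vz))) (n, (f, (x0, e))) ∧
    @den B (Nat :: Fun Nat a :: a :: D) (sub2 q (App (Var (vs vz)) (Var vz))
      (App (Var (vs vz)) (succ (Var vz)))) (n, (f, (x0, e))))).
  { refine (imp_e (all_e (imp_e ax _) x0) _).
    - iintro x. iintro k. apply (sub1_den (F := a :: D) p _ (x, e) e) in k; auto.
      idestruct (imp_e (all_e h x) k) as [y [l m]]. iexists y. isplit.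
      + now apply (sub1_den (F := a :: a :: D) p _ (y, (x, e)) e).
      + now apply (sub2_den (F := a :: a :: D) q _ _ (y, (x, e)) e).
    - now apply (sub1_den (F := a :: D) p _ (x0, e) e). }
  idestruct L as [f [l m]]. iexists f. isplit; auto. iintro n.
  idestruct (all_e m n) as [m1 m2]. isplit.
  - apply (sub1_den (F := Nat :: Fun Nat a :: a :: D) p _ (n, (f, (x0, e))) e) in m1; auto.
  - apply (sub2_den (F := Nat :: Fun Nat a :: a :: D) q _ _ (n, (f, (x0, e))) e) in m2; auto.
Qed.

Lemma function_exists {D a b} (p : fm (b :: a :: D)) (e : env B D) W :
  Inh B a -> Inh B b -> Inh B (Fun a b) -> @okf B _ p ->
  W ⊩ (∀ x : a, ∃ y : b, @den B (b :: a :: D) p (y, (x, e)) ∧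
        ∀ z : b, @den B (b :: a :: D) p (z, (x, e)) → z = y) ->
  W ⊩ (∃ f : Fun a b, ∀ x : a, @den B (b :: a :: D) p (f @ x, (x, e))).
Proof.
  intros ia ib ifab ok h.
  assert (ax := @forces_axiom B D _ (ax_fun_ex D a b p)).
  specialize (ax ltac:(iok) W e).
  assert (L : W ⊩ (∃ f : Fun a b, ∀ x : a, @den B (a :: Fun a b :: D)
    (sub2 p (Var vz) (App (Var (vs vz)) (Var vz))) (x, (f, e)))).
  { refine (imp_e ax _). iintro x. idestruct (all_e h x) as [y [l m]]. iexists y. isplit; auto.
    iintro z. iintro k. iapply (all_e m z).
    apply (@forces_sub B _ p (b :: b :: a :: D) _ (z, (y, (x, e))) (z, (x, e))) in k; auto.
    apply var_cons_ind; reflexivity. }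
  idestruct L as [f l]. iexists f. iintro x. assert (k := all_e l x). cbv beta in k.
  apply (sub2_den (F := a :: Fun a b :: D) p _ _ (x, (f, e)) e) in k; auto.
Qed.

(** The term language has no abstraction, so a function given by a term is obtained from its
    graph. *)
Lemma lambda {D a b} (t : tm (a :: D) b) (e : env B D) W :
  Inh B a -> Inh B b -> Inh B (Fun a b) ->
  W ⊩ (∃ f : Fun a b, ∀ x : a, f @ x = @tden B (a :: D) b t (x, e)).
Proof.
  intros. assert (E : forall y x, @tden B (b :: a :: D) b (tm_ren (fun _ => vs) t) (y, (x, e)) =
    @tden B (a :: D) b t (x, e)) by (intros; apply (@tden_wk B (a :: D))).
  refine (imp_e _ (function_exists (Eq (Var vz) (tm_ren (fun _ => vs) t)) e W _ _ _ _ _)); auto.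
  - iintro k. idestruct k as [f k]. iexists f. iintro x. assert (l := all_e k x).
    cbn [den] in l. now rewrite E in l.
  - iok.
  - iintro x. iexists (@tden B (a :: D) b t (x, e)). isplit.
    + cbn [den]; rewrite E. apply ieq_refl.
    + iintro z. cbn [den]; rewrite E. iintro k. exact k.
Qed.

Lemma fst_pair {W a b} (t : nt B a) (u : nt B b) : W ⊩ fstn (pairn t u) = t.
Proof. exact (forces_axiom (ax_fst [a; b] a b (Var vz) (Var (vs vz))) I W (t, (u, tt))). Qed.
Lemma snd_pair {W a b} (t : nt B a) (u : nt B b) : W ⊩ sndn (pairn t u) = u.
Proof. exact (forces_axiom (ax_snd [a; b] a b (Var vz) (Var (vs vz))) I W (t, (u, tt))). Qed.

(** Dependent choice is applied to pairs (n, y) with q n y, each step raising the first component by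
    one. Started at 0, the sequence has n as its n-th first component, and the second components are
    the choices. *)
Lemma countable_choice {D b} (q : fm (b :: Nat :: D)) (e : env B D) W :
  Inh B b -> Inh B (Fun Nat b) -> Inh B (Fun Nat (Prod Nat b)) -> @okf B _ q ->
  W ⊩ (∀ n : Nat, ∃ y : b, @den B (b :: Nat :: D) q (y, (n, e))) ->
  W ⊩ (∃ c : Fun Nat b, ∀ n : Nat, @den B (b :: Nat :: D) q (c @ n, (n, e))).
Proof.
  intros ib i1 i2 ok h.
  set (p := fm_sub (scons (tsnd (Var vz)) (scons (tfst (Var vz)) (fun s v => Var (vs v)))) q
    : fm (Prod Nat b :: D)).
  set (r := Eq (tfst (Var vz)) (succ (tfst (Var (vs vz)))) : fm (Prod Nat b :: Prod Nat b :: D)).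
  assert (P : forall W z, W ⊩ @den B (Prod Nat b :: D) p (z, e) <->
    W ⊩ @den B (b :: Nat :: D) q (sndn z, (fstn z, e))).
  { intros W' z; apply (@forces_sub B _ q (Prod Nat b :: D)).
    apply var_cons_ind; [|apply var_cons_ind]; auto. }
  assert (C : forall W n m y z, W ⊩ n = m -> W ⊩ y = z ->
    W ⊩ @den B (b :: Nat :: D) q (y, (n, e)) -> W ⊩ @den B (b :: Nat :: D) q (z, (m, e))).
  { intros W' n m y z k l. apply (forces_env_eq q).
    constructor; [|constructor; [|apply env_eq_refl]]; now apply ieq_sym. }
  idestruct (all_e h zeron) as [y0 h0].
  refine (imp_e _ (dependent_choice p r e W (pairn zeron y0) _ _ _ _ _ _)); auto.
  - iintro k. idestruct k as [F [F0 k]].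
    assert (N : W ⊩ (∀ n : Nat, fstn (F @ n) = n)).
    { apply (induction (D := [Fun Nat (Prod Nat b)]) (Eq (tfst (App (Var (vs vz)) (Var vz)))
        (Var vz)) (F, tt)).
      - iok.
      - iden. irewrite F0. apply fst_pair.
      - iintro n. iden. iintro l. idestruct (all_e k n) as [_ m].
        apply (ieq_trans (u := succn (fstn (F @ n)))); [exact m | irewrite l; apply ieq_refl]. }
    idestruct (lambda (D := [Fun Nat (Prod Nat b)]) (tsnd (App (Var (vs vz)) (Var vz)))
      (F, tt) W _ _ _)
      as [c l].
    iexists c. iintro n. idestruct (all_e k n) as [m _]. apply P in m.
    refine (C _ _ _ _ _ (all_e N n) _ m). apply ieq_sym. exact (all_e l n).
  - now apply okf_sub.
  - iok.
  - iintro z. iintro k. idestruct (all_e h (succn (fstn z))) as [y l].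
    iexists (pairn (succn (fstn z)) y). isplit.
    + apply P. refine (C _ _ _ _ _ _ _ l); apply ieq_sym; [apply fst_pair | apply snd_pair].
    + subst r; iden. apply fst_pair.
  - apply P. refine (C _ _ _ _ _ _ _ h0); apply ieq_sym; [apply fst_pair | apply snd_pair].
Qed.

End Schemas.

(** * Natural and real numbers *)

(* Induction is a schema over formulas of the formal language, so the predicate is supplied as
   syntax, together with the values of its parameters. *)
Tactic Notation "iinduction" hyp(var) "using" uconstr(predicate) uconstr(parameters) :=
  refine (all_e (induction predicate parameters _ _ _ _) var);
  [ iok | iden; clear var | iden; clear var; iintro var ].

Section Numbers.
Context {B : ctx}.
Implicit Types W : world B.

#[local] Notation v0 := (Var vz).
#[local] Notation v1 := (Var (vs vz)).
#[local] Notation v2 := (Var (vs (vs vz))).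

Lemma archimedean W x : W ⊩ (∃ n : Nat, x < ofnatn n).
Proof. refine (forces_axiom (ax_archimedean [Real] v0) _ W (x, tt)); iok. Qed.
Lemma ofnat_zero W : W ⊩ ofnatn zeron = 0.
Proof. exact (forces_axiom (ax_ofnat_zero []) I W tt). Qed.
Lemma ofnat_succ W n : W ⊩ ofnatn (succn n) = ofnatn n + 1.
Proof. exact (forces_axiom (ax_ofnat_succ [Nat] v0) I W (n, tt)). Qed.
Lemma incl_le_one W (t : nt B Interval) : W ⊩ incln t <= 1.
Proof. refine (forces_axiom (ax_incl_le_one [Interval] v0) _ W (t, tt)); iok. Qed.
Lemma complete W (x : nt B (Fun Nat Real)) :
  W ⊩ (∀ e : Real, 0 < e → ∃ N : Nat, ∀ m : Nat, ∀ n : Nat,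
        N ≼ m → N ≼ n → rabsn (x @ m - x @ n) < e) ->
  W ⊩ (∃ l : Real, ∀ e : Real, 0 < e → ∃ N : Nat, ∀ n : Nat,
        N ≼ n → rabsn (x @ n - l) < e).
Proof. refine (imp_e (forces_axiom (ax_complete [Fun Nat Real] v0) _ W (x, tt))); iok. Qed.

(** Cotransitivity at the maximum M gives M < z, or else both x < M and y < M; by the least upper
    bound axiom these yield x < y and y < x. *)
Lemma max_lt W x y z : W ⊩ x < z -> W ⊩ y < z -> W ⊩ rmaxn x y < z.
Proof.
  intros h k. idestruct (lt_cotrans W x z (rmaxn x y) h) as [l|l]; auto.
  assert (m : W ⊩ x < y).
  { idestruct (max_lub W x y x l) as [m|m]; auto. apply ex_falso; exact (lt_irrefl m). }
  idestruct (lt_cotrans W y z (rmaxn x y) k) as [n|n]; auto.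
  idestruct (max_lub W x y y n) as [o|o]; ilra.
Qed.

Lemma max_le W x y z : W ⊩ x <= z -> W ⊩ y <= z -> W ⊩ rmaxn x y <= z.
Proof. intros h k. iintro l. idestruct (max_lub W x y z l) as [m|m]; ilra. Qed.

Lemma abs_ge W x : W ⊩ x <= rabsn x.
Proof. apply max_l. Qed.
Lemma abs_ge_opp W x : W ⊩ - x <= rabsn x.
Proof. apply max_r. Qed.
Lemma abs_lt W x z : W ⊩ x < z -> W ⊩ - x < z -> W ⊩ rabsn x < z.
Proof. apply max_lt. Qed.
Lemma abs_le W x z : W ⊩ x <= z -> W ⊩ - x <= z -> W ⊩ rabsn x <= z.
Proof. apply max_le. Qed.
Lemma abs_nonneg W x : W ⊩ 0 <= rabsn x.
Proof. pose proof (abs_ge W x). pose proof (abs_ge_opp W x). ilra. Qed.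

(** The signs of the factors cannot be decided, but the goal is a negation. Assume x y < 0. If x >
    0, then y cannot be positive, so y = 0 and x y = 0. Thus x = 0, and again x y = 0. *)
Lemma mul_nonneg W x y : W ⊩ 0 <= x -> W ⊩ 0 <= y -> W ⊩ 0 <= x * y.
Proof.
  intros h k. iintro l.
  assert (hx : W ⊩ x <= 0).
  { iintro m. assert (hy : W ⊩ y <= 0).
    { iintro n. assert (o := lt_mul W x y m n). ilra. }
    assert (ey : W ⊩ y = 0) by ilra.
    assert (e : W ⊩ x * y = x * 0) by (irewrite ey; apply ieq_refl).
    ilra. }
  assert (ex : W ⊩ x = 0) by ilra. assert (e : W ⊩ x * y = 0 * y) by (irewrite ex; apply ieq_refl).
  ilra.
Qed.

Lemma nat_nonneg W n : W ⊩ 0 <= ofnatn n.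
Proof.
  iinduction n using (abs1 (fun n => 0 <= ofnat n)%B) tt.
  - pose proof (ofnat_zero W). ilra.
  - iintro h. pose proof (ofnat_succ W n). ilra.
Qed.

Lemma nat_cases W n : W ⊩ n = zeron ∨ ∃ m : Nat, n = succn m.
Proof.
  iinduction n using (abs1 (fun n => n = zero ∨ ∃ m : Nat, #n = succ #m)%B) tt.
  - apply or_l, ieq_refl.
  - iintro h. apply or_r. iexists n. apply ieq_refl.
Qed.

(** The order is inherited from the reals, where it is undecidable; the decision comes from
    induction on n with a case distinction on m. *)
Lemma nat_le_or_lt W n m : W ⊩ n ≼ m ∨ succn m ≼ n.
Proof.
  revert m. change (W ⊩ (∀ m : Nat, n ≼ m ∨ succn m ≼ n)).
  iinduction n using (abs1 (fun n => ∀ m : Nat, #n ≼ #m ∨ succ #m ≼ #n)%B) tt.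
  - iintro m. apply or_l. pose proof (ofnat_zero W). pose proof (nat_nonneg W m). ilra.
  - iintro h. iintro m. pose proof (ofnat_succ W n). pose proof (nat_nonneg W n).
    idestruct (nat_cases W m) as [e|e].
    + apply or_r. irewrite e. pose proof (ofnat_succ W zeron). pose proof (ofnat_zero W). ilra.
    + idestruct e as [k e]. pose proof (ofnat_succ W k). pose proof (ofnat_succ W (succn k)).
      idestruct (all_e h k) as [l|l]; [apply or_l | apply or_r]; irewrite e; ilra.
Qed.
Lemma nat_antisym W n m : W ⊩ n ≼ m -> W ⊩ m ≼ n -> W ⊩ n = m.
Proof.
  cut (W ⊩ (∀ m : Nat, n ≼ m → m ≼ n → n = m)).
  { intros h k l. exact (imp_e (imp_e (all_e h m) k) l). }
  iinduction n using (abs1 (fun n => ∀ m : Nat, #n ≼ #m → #m ≼ #n → #n = #m)%B) tt.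
  - iintro k. iintro h. iintro l. idestruct (nat_cases W k) as [e|e]; [now apply ieq_sym|].
    idestruct e as [j e].
    assert (l' : W ⊩ succn j ≼ zeron) by (irewrite <- e; exact l).
    pose proof (nat_nonneg W j). pose proof (ofnat_succ W j). pose proof (ofnat_zero W).
    apply ex_falso. ilra.
  - iintro IH. iintro k. iintro h. iintro l. idestruct (nat_cases W k) as [e|e].
    + assert (l' : W ⊩ succn n ≼ zeron) by (irewrite <- e; exact h).
      pose proof (nat_nonneg W n). pose proof (ofnat_succ W n). pose proof (ofnat_zero W).
      apply ex_falso. ilra.
    + idestruct e as [j e].
      assert (h' : W ⊩ succn n ≼ succn j) by (irewrite <- e; exact h).
      assert (l' : W ⊩ succn j ≼ succn n) by (irewrite <- e; exact l).
      pose proof (ofnat_succ W j). pose proof (ofnat_succ W n).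
      irewrite e. assert (q : W ⊩ n = j).
      { refine (imp_e (imp_e (all_e IH j) _) _); ilra. }
      irewrite q. apply ieq_refl.
Qed.

Lemma nat_le_succ W k n : W ⊩ k ≼ succn n -> W ⊩ k ≼ n ∨ k = succn n.
Proof.
  intro h. idestruct (nat_le_or_lt W k n) as [l|l]; [now apply or_l | apply or_r].
  now apply nat_antisym.
Qed.

Lemma nat_le_zero W k : W ⊩ k ≼ zeron -> W ⊩ k = zeron.
Proof.
  intro h. apply nat_antisym; auto. pose proof (nat_nonneg W k). pose proof (ofnat_zero W). ilra.
Qed.

Lemma nat_max W n m : W ⊩ (∃ k : Nat, n ≼ k ∧ m ≼ k).
Proof.
  idestruct (nat_le_or_lt W n m) as [h|h].
  - iexists m. isplit; ilra.
  - iexists n. pose proof (ofnat_succ W m). isplit; ilra.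
Qed.

Lemma nat_mul_pos W n z : W ⊩ 0 < ofnatn n * z -> W ⊩ 0 < z.
Proof.
  cut (W ⊩ (0 < ofnatn n * z → 0 < z)); [exact imp_e|].
  iinduction n using (abs2 (fun n z => 0 < ofnat n * z → 0 < z)%B) (z, tt).
  - iintro h. assert (e : W ⊩ ofnatn zeron * z = 0 * z) by (irewrite (ofnat_zero W);
      apply ieq_refl).
    ilra.
  - iintro IH. iintro h.
    assert (e : W ⊩ ofnatn (succn n) * z = (ofnatn n + 1) * z)
      by (irewrite (ofnat_succ W n); apply ieq_refl).
    assert (k : W ⊩ 0 < ofnatn n * z + z) by ilra.
    idestruct (add_pos_cases k) as [l|l]; auto. exact (imp_e IH l).
Qed.

(** The axiom does not give the sign of y. Take n > x and compare n y with 0 and 1: if n y < 1, then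
    x (1 - n y) = x - n would be positive, so 0 < n y and y is positive. *)
Lemma inverse W x : W ⊩ 0 < x -> W ⊩ (∃ y : Real, 0 < y ∧ x * y = 1).
Proof.
  intro h. idestruct (inv_ex W x (or_r h)) as [y e]. iexists y. isplit; auto.
  idestruct (archimedean W x) as [n l].
  idestruct (lt_cotrans W 0 1 (ofnatn n * y) (lt_zero_one W)) as [k|k].
  - exact (nat_mul_pos W n y k).
  - assert (m : W ⊩ 0 < x * (1 - ofnatn n * y)) by (apply lt_mul; ilra).
    assert (e' : W ⊩ ofnatn n * (x * y) = ofnatn n * 1) by (irewrite e; apply ieq_refl).
    ilra.
Qed.

End Numbers.

(** * The limited anti-Specker property implies positivity *)

Definition POS_sentence : sentence :=
  (∀ f : Fun (pt unit_interval) Real,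
     pointwise_continuous unit_interval #f →
     (∀ x : pt unit_interval, 0 < #f @ #x) →
     ∀ m : Real, is_inf unit_interval #f #m → 0 < #m)%B.

(** The quantifiers over rho, j and w are kept apart: once they are introduced, w is a variable of
    sort [E] and shows that [E] is inhabited. *)
Definition AS_formula (E : sort) : fm [E; Fun Interval E; Fun E (Fun E Real)] :=
  abs3 (fun w j rho =>
     is_metric rho →
     is_isometry unit_interval rho j →
     apart_from_space unit_interval rho j w →
     ∀ u : Fun Nat E,
       (∀ n : Nat, (∃ x : pt unit_interval, #u @ #n = #j @ #x) ∨ #u @ #n = #w) →
       (∀ x : pt unit_interval, eventually_bounded_away #rho #u (#j @ #x)) →
       ∃ n : Nat, #u @ #n = #w)%B.

Definition AS_sentence (E : sort) : sentence :=
  All (Fun E (Fun E Real)) (All (Fun Interval E) (All E (AS_formula E))).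

Lemma AS_sentence_spec E : AS_L unit_interval (AS_sentence E).
Proof. exists E. reflexivity. Qed.

Ltac iunfold := cbv beta delta [POS_sentence AS_sentence AS_formula unit_interval pt dist
  pointwise_continuous is_inf
  is_metric is_isometry apart_from_space eventually_bounded_away rabs]; cbv beta iota; iden.

Section Real.
Context {B : ctx}.
Implicit Types W : world B.

Lemma half W x : W ⊩ 0 < x -> W ⊩ (∃ y : Real, 0 < y ∧ y + y = x).
Proof.
  intro h. pose proof (lt_zero_one W). assert (k : W ⊩ 0 < 1 + 1) by ilra.
  idestruct (inverse W (1 + 1) k) as [i [i0 ie]]. iexists (x * i). isplit.
  - now apply lt_mul.
  - assert (e : W ⊩ x * ((1 + 1) * i) = x * 1) by (irewrite ie; apply ieq_refl). ilra.
Qed.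

Lemma min_pos W x y : W ⊩ 0 < x -> W ⊩ 0 < y ->
  W ⊩ (∃ d : Real, 0 < d ∧ d <= x ∧ d <= y).
Proof.
  (* This is the minimum of x and y, expressed by the primitive maximum. *)
  intros h k. iexists (- rmaxn (- x) (- y)). isplit; [|isplit].
  - assert (l : W ⊩ rmaxn (- x) (- y) < 0) by (apply max_lt; ilra). ilra.
  - pose proof (max_l W (- x) (- y)). ilra.
  - pose proof (max_r W (- x) (- y)). ilra.
Qed.

Lemma function_ext W a b (f g : nt B (Fun a b)) : Inh B a ->
  W ⊩ (∀ x : a, f @ x = g @ x) -> W ⊩ f = g.
Proof.
  intros ia h. refine (imp_e (forces_axiom (ax_fun_ext [Fun a b; Fun a b] a b (Var vz)
    (Var (vs vz))) _ W (f, (g, tt))) h). iok.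
Qed.

(** The metric is curried: each x first gets a function of y, and extensionality makes that function
    unique, so that function existence applies again. *)
Lemma real_metric W : W ⊩ (∃ rho : Fun Real (Fun Real Real),
  ∀ x : Real, ∀ y : Real, rho @ x @ y = rabsn (x - y)).
Proof.
  assert (Inh B (Fun Real (Fun Real Real))) by exact (inhabits (Cst c_radd)).
  assert (Inh B (Fun Real Real)) by exact (inhabits (Cst c_ropp)).
  refine (function_exists (abs2 (fun g x => ∀ y : Real, #g @ #y = rabs
    (#x - #y))%B) tt W _ _ _ _ _).
  - iok.
  - iden. iintro x.
    idestruct (lambda (D := [Real]) (rabs (Var (vs vz) - Var vz))%B (x, tt) W _ _ _) as [g h].
    iden in h. iexists g. isplit; auto. iintro g'. iintro h'. apply function_ext; [apply inh_real|].
    iintro y. apply (ieq_trans (all_e h' y)), ieq_sym, (all_e h y).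
Qed.

End Real.

Section ASImpliesPOS.
Context {B : ctx} {inhI : Inh B Interval} {inhC : Inh B (Fun Nat (Prod Nat Real))}.

Lemma POS_of_AS (W : world B) : W ⊩ den (AS_sentence Real) tt -> W ⊩ den POS_sentence tt.
Proof.
  intro AS. revert AS. iunfold. intro AS.
  iintro f. iintro cont. iintro pos. iintro m. iintro [low approx].
  idestruct (real_metric W) as [rho Hrho].
  (* The alternative with value 1 + 1 records 0 < m, so that finding w yields the conclusion. Bounds
     by 1 / (n + 1) are multiplied out. *)
  assert (C : W ⊩ (∃ u : Fun Nat Real, ∀ n : Nat,
    (∃ x : Interval, u @ n = incln x ∧ f @ x * ofnatn (succn n) < 1) ∨ (u @ n = 1 + 1 ∧ 0 < m))).
  { refine (countable_choice (abs4 (fun y n f m =>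
      (∃ x : Interval, #y = incl #x ∧ #f @ #x * ofnat (succ #n) < 1) ∨ (y = 1 + 1 ∧ 0 < m))%B)
      (f, (m, tt)) W _ _ _ _ _).
    - iok.
    - iden. iintro n. pose proof (nat_nonneg W n). pose proof (ofnat_succ W n).
      assert (p : W ⊩ 0 < ofnatn (succn n)) by ilra.
      idestruct (inverse W _ p) as [i [i0 ie]].
      idestruct (lt_cotrans W 0 i m i0) as [k|k].
      + iexists (1 + 1)%nt. apply or_r. isplit; [apply ieq_refl | auto].
      (* Here i = 1 / (n + 1) exceeds m, and precision i - m in the infimum gives f(x) < i. *)
      + assert (k' : W ⊩ 0 < i - m) by ilra.
        idestruct (imp_e (all_e approx (i - m)%nt) k') as [x Hx].
        iexists (incln x). apply or_l. iexists x. isplit; [apply ieq_refl|].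
        assert (l : W ⊩ 0 < (i - f @ x) * ofnatn (succn n)) by (apply lt_mul; ilra).
        ilra. }
  idestruct C as [u Hu].
  assert (R : W ⊩ (∃ n : Nat, u @ n = 1 + 1)).
  { refine (imp_e (imp_e (all_e (imp_e (imp_e (imp_e
      (all_e (all_e (all_e AS rho) (NC c_incl)) (1 + 1)%nt) _) _) _) u) _) _); cbv beta.
    - isplit; [|isplit; [|isplit; [|isplit]]].
      + iintro x. iintro y. pose proof (all_e (all_e Hrho x) y) as e. cbv beta in e.
        pose proof (abs_nonneg W (x - y)). ilra.
      + iintro x. pose proof (all_e (all_e Hrho x) x) as e. cbv beta in e.
        assert (k : W ⊩ rabsn (x - x) <= 0) by (apply abs_le; ilra).
        pose proof (abs_nonneg W (x - x)). ilra.
      + iintro x. iintro y. iintro h. pose proof (all_e (all_e Hrho x) y) as e. cbv beta in e.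
        pose proof (abs_ge W (x - y)). pose proof (abs_ge_opp W (x - y)). ilra.
      + iintro x. iintro y. pose proof (all_e (all_e Hrho x) y) as e. cbv beta in e.
        pose proof (all_e (all_e Hrho y) x) as e'. cbv beta in e'.
        pose proof (abs_ge W (x - y)). pose proof (abs_ge_opp W (x - y)).
        pose proof (abs_ge W (y - x)). pose proof (abs_ge_opp W (y - x)).
        assert (k : W ⊩ rabsn (x - y) <= rabsn (y - x)) by (apply abs_le; ilra).
        assert (k' : W ⊩ rabsn (y - x) <= rabsn (x - y)) by (apply abs_le; ilra).
        ilra.
      + iintro x. iintro y. iintro z.
        pose proof (all_e (all_e Hrho x) z) as e1. cbv beta in e1.
        pose proof (all_e (all_e Hrho x) y) as e2. cbv beta in e2.
        pose proof (all_e (all_e Hrho y) z) as e3. cbv beta in e3.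
        pose proof (abs_ge W (x - y)). pose proof (abs_ge_opp W (x - y)).
        pose proof (abs_ge W (y - z)). pose proof (abs_ge_opp W (y - z)).
        assert (k : W ⊩ rabsn (x - z) <= rabsn (x - y) + rabsn (y - z)) by (apply abs_le; ilra).
        ilra.
    - iintro x. iintro y. exact (all_e (all_e Hrho (incln x)) (incln y)).
    - iexists 1%nt. isplit; [apply lt_zero_one|]. iintro y.
      pose proof (all_e (all_e Hrho (1 + 1)%nt) (incln y)) as e. cbv beta in e.
      pose proof (abs_ge W (1 + 1 - incln y)). pose proof (incl_le_one W y). ilra.
    - iintro n. idestruct (all_e Hu n) as [h|[h _]].
      + idestruct h as [x [h _]]. apply or_l. iexists x. exact h.
      + now apply or_r.
    (* Let c = f(x) / 2. Within d of x, f exceeds c, whereas f(u_n) < 1 / (n + 1) < c for n >= N > 1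
       / c. Capping d by 1 also keeps w = 2 away. *)
    - iintro x. idestruct (half W _ (all_e pos x)) as [c [c0 ce]].
      idestruct (imp_e (all_e (all_e cont x) c) c0) as [d [d0 Hd]].
      idestruct (min_pos W d 1 d0 (lt_zero_one W)) as [d' [d'0 [d'd d'1]]].
      idestruct (inverse W c c0) as [i [i0 ie]].
      idestruct (archimedean W i) as [N HN].
      iexists N. iexists d'. isplit; auto. iintro n. iintro Nn.
      pose proof (all_e (all_e Hrho (incln x)) (u @ n)) as e. cbv beta in e.
      idestruct (all_e Hu n) as [h|[h _]].
      + idestruct h as [z [h k]]. iintro l.
        assert (l' : W ⊩ rabsn (incln x - incln z) < d).
        { assert (q : W ⊩ rho @ incln x @ (u @ n) = rabsn (incln x - incln z)).
          { apply (ieq_trans e). irewrite h. apply ieq_refl. }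
          ilra. }
        pose proof (imp_e (all_e Hd z) l') as fz. cbv beta in fz.
        pose proof (abs_ge W (f @ x - f @ z)). pose proof (ofnat_succ W n).
        pose proof (nat_nonneg W n).
        assert (p1 : W ⊩ 0 < (f @ z - c) * ofnatn (succn n)) by (apply lt_mul; ilra).
        assert (p2 : W ⊩ 0 < c * (ofnatn (succn n) - i)) by (apply lt_mul; ilra).
        ilra.
      + pose proof (abs_ge_opp W (incln x - u @ n)). pose proof (incl_le_one W x). ilra. }
  idestruct R as [n Hn]. idestruct (all_e Hu n) as [h|[_ h]]; auto.
  idestruct h as [x [h _]]. pose proof (incl_le_one W x). pose proof (lt_zero_one W). ilra.
Qed.

End ASImpliesPOS.

(** * Positivity implies the limited anti-Specker property *)

Notation is_inf_upto g n v :=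
  ((∀ k : Nat, k ≼ n → v <= g @ k) ∧
   (∀ e : Real, 0 < e → ∃ k : Nat, k ≼ n ∧ g @ k < v + e))%nt.

Section FiniteInf.
Context {B : ctx}.

(** The new value is the minimum of v and g_(n+1). Which of the two attains it is undecidable, but
    one of them lies within e of it; hence the approximate form of the statement. *)
Lemma finite_inf (W : world B) g n : W ⊩ (∃ v : Real, is_inf_upto g n v).
Proof.
  iinduction n using (abs2 (fun n g => ∃ v : Real, (∀ k : Nat, #k ≼ #n → #v <= #g @ #k) ∧
    (∀ e : Real, 0 < #e → ∃ k : Nat, #k ≼ #n ∧ #g @ #k < #v + #e))%B) (g, tt).
  - iexists (g @ zeron)%nt. isplit.
    + iintro k. iintro h. irewrite (nat_le_zero W k h). apply le_refl.
    + iintro e. iintro h. iexists zeron. isplit; [apply le_refl | ilra].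
  - iintro IH. idestruct IH as [v [low approx]].
    pose proof (ofnat_succ W n) as sn.
    pose proof (max_l W (- v) (- (g @ succn n))) as ml.
    pose proof (max_r W (- v) (- (g @ succn n))) as mr.
    iexists (- rmaxn (- v) (- (g @ succn n)))%nt. isplit.
    + iintro k. iintro h. idestruct (nat_le_succ W k n h) as [l|l].
      * pose proof (imp_e (all_e low k) l) as q. ilra.
      * irewrite l. ilra.
    + iintro e. iintro h.
      assert (k : W ⊩ rmaxn (- v) (- (g @ succn n)) - e < rmaxn (- v) (- (g @ succn n))) by ilra.
      idestruct (max_lub W _ _ _ k) as [l|l].
      * assert (p : W ⊩ 0 < - rmaxn (- v) (- (g @ succn n)) + e - v) by ilra.
        idestruct (imp_e (all_e approx _) p) as [i [hi gi]]. iexists i. isplit; ilra.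
      * iexists (succn n). isplit; ilra.
Qed.

End FiniteInf.

(** * Heights, slopes and centres of the spikes *)

Notation triple := (Prod Real (Prod Real Interval)).

(* Either no [u_l] with [l <= k] is [w], and then [g_k = 1 / (k + 1)], [b_k = k] and
   [u_k = y_k]; or some [u_l] with [l <= k] is [w], and then [g_k = 1] and [b_k = 0]. *)
Notation stage u j w k g b y :=
  (((∀ l : Nat, l ≼ k → ∃ x : Interval, u @ l = j @ x) ∧
    g * ofnatn (succn k) = 1 ∧ b = ofnatn k ∧ u @ k = j @ y) ∨
   ((∃ l : Nat, l ≼ k ∧ u @ l = w) ∧ g = 1 ∧ b = 0))%nt.

Section Data.
Context {B : ctx} {E : sort}.
Context {inhI : Inh B Interval} {inhNI : Inh B (Fun Nat Interval)} {inhT : Inh B (Fun Nat triple)}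
  {inhC : Inh B (Fun Nat (Prod Nat triple))}.

Lemma search (W : world B) (u : nt B (Fun Nat E)) j w k :
  W ⊩ (∀ n : Nat, (∃ x : Interval, u @ n = j @ x) ∨ u @ n = w) ->
  W ⊩ (∀ l : Nat, l ≼ k → ∃ x : Interval, u @ l = j @ x) ∨ (∃ l : Nat, l ≼ k ∧ u @ l = w).
Proof.
  intro U.
  iinduction k using (abs4 (fun k u j w => (∀ l : Nat, #l ≼ #k →
    ∃ x : Interval, #u @ #l = #j @ #x) ∨
    (∃ l : Nat, #l ≼ #k ∧ #u @ #l = #w))%B) (u, (j, (w, tt))).
  - idestruct (all_e U zeron) as [h|h].
    + apply or_l. iintro l. iintro hl. idestruct h as [x h]. iexists x.
      irewrite (nat_le_zero W l hl). exact h.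
    + apply or_r. iexists zeron. isplit; [apply le_refl | exact h].
  - iintro IH. pose proof (ofnat_succ W k) as sk. idestruct IH as [IH|IH].
    + idestruct (all_e U (succn k)) as [h|h].
      * apply or_l. iintro l. iintro hl. idestruct (nat_le_succ W l k hl) as [q|q].
        -- exact (imp_e (all_e IH l) q).
        -- idestruct h as [x h]. iexists x. irewrite q. exact h.
      * apply or_r. iexists (succn k). isplit; [apply le_refl | exact h].
    + apply or_r. idestruct IH as [l [hl h]]. iexists l. isplit; [ilra | exact h].
Qed.

Lemma interval_point (W : world B) : W ⊩ (∃ t : Interval, incln t = 0).
Proof.
  pose proof (lt_zero_one W).
  refine (imp_e (imp_e (forces_axiom (ax_incl_surj [] 0%B) _ W tt) _) _); [iok | |]; iden; ilra.
Qed.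

Lemma stages (W : world B) (u : nt B (Fun Nat E)) j w :
  W ⊩ (∀ n : Nat, (∃ x : Interval, u @ n = j @ x) ∨ u @ n = w) ->
  W ⊩ (∃ g : Fun Nat Real, ∃ b : Fun Nat Real, ∃ y : Fun Nat Interval,
        ∀ k : Nat, stage u j w k (g @ k) (b @ k) (y @ k)).
Proof.
  intro U.
  assert (C : W ⊩ (∃ c : Fun Nat triple, ∀ k : Nat,
    stage u j w k (fstn (c @ k)) (fstn (sndn (c @ k))) (sndn (sndn (c @ k))))).
  { refine (countable_choice (abs5 (fun z k u j w =>
      ((∀ l : Nat, #l ≼ #k → ∃ x : Interval, #u @ #l = #j @ #x) ∧
        tfst z * ofnat (succ k) = 1 ∧ tfst (tsnd z) = ofnat k ∧ u @ k = j @ tsnd (tsnd z)) ∨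
      ((∃ l : Nat, #l ≼ #k ∧ #u @ #l = #w) ∧ tfst z = 1 ∧ tfst (tsnd z) = 0))%B)
      (u, (j, (w, tt))) W _ _ _ _ _).
    - iok.
    - iden. iintro k. idestruct (search W u j w k U) as [h|h].
      + idestruct (imp_e (all_e h k) le_refl) as [y hy].
        pose proof (nat_nonneg W k). pose proof (ofnat_succ W k).
        assert (p : W ⊩ 0 < ofnatn (succn k)) by ilra.
        idestruct (inverse W _ p) as [i [i0 ie]].
        iexists (pairn i (pairn (ofnatn k) y)). apply or_l. isplit; [exact h|].
        isplit; [irewrite (fst_pair (W := W) i (pairn (ofnatn k) y)); ilra|].
        isplit; irewrite (snd_pair (W := W) i (pairn (ofnatn k) y)).
        * apply fst_pair.
        * irewrite (snd_pair (W := W) (ofnatn k) y). exact hy.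
      (* The point is a default centre: with slope 0 the spike is the constant 1. *)
      + idestruct (interval_point W) as [y _].
        iexists (pairn 1 (pairn 0 y)). apply or_r. isplit; [exact h|].
        isplit; [apply fst_pair|]. irewrite (snd_pair (W := W) 1%nt (pairn 0 y)). apply fst_pair. }
  idestruct C as [c Hc].
  idestruct (lambda (D := [Fun Nat triple]) (tfst (App (Var (vs vz)) (Var vz))) (c, tt) W _ _ _)
    as [g Hg]. iden in Hg.
  idestruct (lambda (D := [Fun Nat triple]) (tfst (tsnd (App (Var (vs vz)) (Var vz)))) (c, tt) W
    _ _ _) as [b Hb]. iden in Hb.
  idestruct (lambda (D := [Fun Nat triple]) (tsnd (tsnd (App (Var (vs vz)) (Var vz)))) (c, tt) W
    _ _ _) as [y Hy]. iden in Hy.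
  iexists g. iexists b. iexists y. iintro k.
  idestruct (all_e Hc k) as [[h [hg [hb hy]]]|[h [hg hb]]]; [apply or_l | apply or_r].
  - isplit; [exact h|]. isplit; [irewrite (all_e Hg k); exact hg|].
    isplit; [irewrite (all_e Hb k); exact hb|]. irewrite (all_e Hy k); exact hy.
  - isplit; [exact h|]. isplit; [irewrite (all_e Hg k); exact hg|]. irewrite (all_e Hb k); exact hb.
Qed.

End Data.

(** * Infimum of the spikes at a point *)

Notation spike g b y x k := (g @ k + b @ k * rabsn (incln x - incln (y @ k)))%nt.
Notation is_spike_inf g b y x v :=
  ((∀ k : Nat, v <= spike g b y x k) ∧
   (∀ e : Real, 0 < e → ∃ k : Nat, spike g b y x k < v + e))%nt.

Section Spikes.
Context {B : ctx} {inhI : Inh B Interval}.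

(** The constant spike caps the infimum at 1, which disposes of every spike that is at least 1. *)
Lemma spike_zero (W : world B) g b y x :
  W ⊩ g @ zeron = 1 -> W ⊩ b @ zeron = 0 -> W ⊩ spike g b y x zeron = 1.
Proof. intros hg hb. irewrite hg. irewrite hb. iring. Qed.

(** A spike nearly attaining v' at x' has index at most N, hence slope at most N, and its value at x
    is larger by at most N |x - x'|; or it is at least 1, while v is at most 1. *)
Lemma spike_inf_lipschitz (W : world B) g b y N x x' v v' :
  W ⊩ (∀ k : Nat, 0 <= b @ k ∧ b @ k <= ofnatn k) ->
  W ⊩ g @ zeron = 1 -> W ⊩ b @ zeron = 0 ->
  W ⊩ (∀ k : Nat, N ≼ k → 1 <= spike g b y x' k) ->
  W ⊩ is_spike_inf g b y x v -> W ⊩ is_spike_inf g b y x' v' ->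
  W ⊩ v - ofnatn N * rabsn (incln x - incln x') <= v'.
Proof.
  intros bd g0 b0 far hv hv'. idestruct hv as [low _]. idestruct hv' as [_ approx].
  set (t := rabsn (incln x - incln x')). iintro l.
  assert (l' : W ⊩ 0 < v - ofnatn N * t - v') by ilra.
  idestruct (imp_e (all_e approx _) l') as [k hk].
  pose proof (nat_nonneg W N) as Nn. pose proof (abs_nonneg W (incln x - incln x')) as tn.
  fold t in tn.
  idestruct (nat_le_or_lt W k N) as [kN|kN].
  - pose proof (all_e low k) as vk. cbv beta in vk. idestruct (all_e bd k) as [b1 b2].
    pose proof (abs_ge W (incln x' - incln (y @ k))) as a1.
    pose proof (abs_ge_opp W (incln x' - incln (y @ k))) as a2.
    pose proof (abs_ge W (incln x - incln x')) as a3.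
    pose proof (abs_ge_opp W (incln x - incln x')) as a4.
    fold t in a3, a4.
    assert (tri : W ⊩ rabsn (incln x - incln (y @ k)) <= t + rabsn (incln x' - incln (y @ k)))
      by (apply abs_le; ilra).
    (* Products are unknowns for linear arithmetic, so the slope bound and the triangle inequality
       are supplied already multiplied. *)
    assert (p1 : W ⊩ 0 <= (ofnatn N - b @ k) * t) by (apply mul_nonneg; ilra).
    assert (p2 : W ⊩ 0 <= b @ k * (t + rabsn (incln x' - incln (y @ k)) -
      rabsn (incln x - incln (y @ k)))) by (apply mul_nonneg; ilra).
    clear a1 a2 a3 a4 tri. ilra.
  - pose proof (ofnat_succ W N) as sN.
    assert (Nk : W ⊩ N ≼ k) by ilra. pose proof (imp_e (all_e far k) Nk) as h1. cbv beta in h1.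
    pose proof (all_e low zeron) as v0. cbv beta in v0.
    pose proof (spike_zero W g b y x g0 b0) as s0.
    assert (p : W ⊩ 0 <= ofnatn N * t) by (apply mul_nonneg; ilra). ilra.
Qed.

(** The minimum of the spikes 0, ..., N serves: later ones are at least 1, the value of spike 0. *)
Lemma spike_inf_exists (W : world B) g b y x N :
  W ⊩ g @ zeron = 1 -> W ⊩ b @ zeron = 0 ->
  W ⊩ (∀ k : Nat, N ≼ k → 1 <= spike g b y x k) ->
  W ⊩ (∃ v : Real, is_spike_inf g b y x v).
Proof.
  intros g0 b0 far.
  idestruct (lambda (D := [Interval; Fun Nat Interval; Fun Nat Real; Fun Nat Real])
    (App (Var (vs (vs (vs (vs vz))))) (Var vz) + App (Var (vs (vs (vs vz)))) (Var vz) *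
      rabs (incl (Var (vs vz)) - incl (App (Var (vs (vs vz))) (Var vz))))%B
    (x, (y, (b, (g, tt)))) W _ _ _) as [h Hh]. unfold rabs in Hh. iden in Hh.
  idestruct (finite_inf W h N) as [v [low approx]]. iexists v.
  assert (Hlow : W ⊩ (∀ k : Nat, v <= spike g b y x k)).
  { iintro k. idestruct (nat_le_or_lt W k N) as [kN|kN].
    - pose proof (imp_e (all_e low k) kN) as q. pose proof (all_e Hh k) as e. cbv beta in e. ilra.
    - pose proof (ofnat_succ W N) as sN. pose proof (ofnat_zero W). pose proof (nat_nonneg W N).
      assert (Nk : W ⊩ N ≼ k) by ilra. pose proof (imp_e (all_e far k) Nk) as h1. cbv beta in h1.
      assert (zN : W ⊩ zeron ≼ N) by ilra.
      pose proof (imp_e (all_e low zeron) zN) as q. pose proof (all_e Hh zeron) as e. cbv beta in e.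
      pose proof (spike_zero W g b y x g0 b0) as s0. ilra. }
  isplit; [exact Hlow|]. iintro e. iintro e0. idestruct (imp_e (all_e approx e) e0) as [k [_ hk]].
  iexists k. pose proof (all_e Hh k) as q. cbv beta in q. ilra.
Qed.

Lemma spike_inf_unique (W : world B) g b y x v v' :
  W ⊩ is_spike_inf g b y x v -> W ⊩ is_spike_inf g b y x v' -> W ⊩ v <= v'.
Proof.
  intros h h'. idestruct h as [low _]. idestruct h' as [_ approx]. iintro l.
  assert (p : W ⊩ 0 < v - v') by ilra. idestruct (imp_e (all_e approx _) p) as [k hk].
  pose proof (all_e low k) as q. cbv beta in q. ilra.
Qed.

End Spikes.

(** * Bounds on heights and slopes *)

Section Bridge.
Context {B : ctx} {E : sort}.

(** The last clause says g_k >= 1 / (n + 1) for all k <= n, a common lower bound for the first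
    spikes. *)
Lemma stage_bounds (W : world B) (u : nt B (Fun Nat E)) j w k g b y :
  W ⊩ stage u j w k g b y ->
  W ⊩ 0 < g ∧ 0 <= b ∧ b <= ofnatn k ∧ ∀ n : Nat, k ≼ n → 1 <= g * ofnatn (succn n).
Proof.
  intro h. pose proof (nat_nonneg W k) as kn. pose proof (lt_zero_one W) as one.
  pose proof (ofnat_succ W k) as sk.
  idestruct h as [[_ [hg [hb _]]]|[_ [hg hb]]].
  - assert (p : W ⊩ 0 < g).
    { apply (nat_mul_pos W (succn k)). ilra. }
    isplit; [exact p|]. isplit; [ilra|]. isplit; [ilra|]. iintro n. iintro kn'.
    pose proof (ofnat_succ W n) as sn.
    assert (q : W ⊩ 0 <= g * (ofnatn (succn n) - ofnatn (succn k))) by (apply mul_nonneg; ilra).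
    ilra.
  - isplit; [ilra|]. isplit; [ilra|]. isplit; [ilra|]. iintro n. iintro kn'.
    pose proof (ofnat_succ W n) as sn. irewrite hg. ilra.
Qed.

Lemma stage_zero (W : world B) (u : nt B (Fun Nat E)) j w g b y :
  W ⊩ stage u j w zeron g b y -> W ⊩ g = 1 ∧ b = 0.
Proof.
  intro h. pose proof (ofnat_zero W). pose proof (ofnat_succ W zeron) as sk.
  idestruct h as [[_ [hg [hb _]]]|[_ [hg hb]]].
  - assert (s1 : W ⊩ ofnatn (succn zeron) = 1) by ilra.
    assert (e : W ⊩ g * ofnatn (succn zeron) = g * 1) by (irewrite s1; apply ieq_refl).
    isplit; ilra.
  - isplit; auto.
Qed.

End Bridge.

(** * The function f and its infimum *)

Section POSImpliesAS.
Context {B : ctx} {E : sort}.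
Context {inhI : Inh B Interval} {inhNI : Inh B (Fun Nat Interval)} {inhT : Inh B (Fun Nat triple)}
  {inhC : Inh B (Fun Nat (Prod Nat triple))} {inhR : Inh B (Fun Nat (Prod Nat Real))}.

(** If |x - u_k| >= d and x' lies within c = d / 2 of x, then |x' - u_k| >= c, and slope k >= 1 / c
    lifts the spike to at least 1. Once w has occurred, the spike equals 1 anyway. *)
Lemma spikes_far (W : world B) (rho : nt B (Fun E (Fun E Real))) j u w g b y x :
  W ⊩ (∀ x : Interval, ∀ x' : Interval, rho @ (j @ x) @ (j @ x') = rabsn (incln x - incln x')) ->
  W ⊩ (∀ k : Nat, stage u j w k (g @ k) (b @ k) (y @ k)) ->
  W ⊩ (∃ N : Nat, ∃ d : Real, 0 < d ∧ ∀ n : Nat, N ≼ n → d <= rho @ (j @ x) @ (u @ n)) ->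
  W ⊩ (∃ N : Nat, ∃ d : Real, 0 < d ∧ ∀ x' : Interval, rabsn (incln x - incln x') < d →
        ∀ k : Nat, N ≼ k → 1 <= spike g b y x' k).
Proof.
  intros iso st away. idestruct away as [N0 away]. idestruct away as [d [d0 away]].
  idestruct (half W d d0) as [c [c0 cd]]. idestruct (inverse W c c0) as [i [i0 ci]].
  idestruct (archimedean W i) as [N1 iN]. idestruct (nat_max W N0 N1) as [N [N0N N1N]].
  iexists N. iexists c. isplit; [exact c0|]. iintro x'. iintro near. iintro k. iintro Nk.
  idestruct (all_e st k) as [[_ [hg [hb hu]]]|[_ [hg hb]]].
  - idestruct (stage_bounds W u j w k (g @ k) (b @ k) (y @ k) (all_e st k)) as [g1 _].
    assert (N0k : W ⊩ N0 ≼ k) by ilra.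
    pose proof (imp_e (all_e away k) N0k) as far. cbv beta in far.
    assert (e : W ⊩ rho @ (j @ x) @ (u @ k) = rabsn (incln x - incln (y @ k))).
    { irewrite hu. exact (all_e (all_e iso x) (y @ k)%nt). }
    pose proof (abs_ge W (incln x - incln x')) as a1.
    pose proof (abs_ge_opp W (incln x - incln x')) as a2.
    pose proof (abs_ge W (incln x' - incln (y @ k))) as a3.
    pose proof (abs_ge_opp W (incln x' - incln (y @ k))) as a4.
    assert (tri : W ⊩ rabsn (incln x - incln (y @ k)) <=
      rabsn (incln x - incln x') + rabsn (incln x' - incln (y @ k))) by (apply abs_le; ilra).
    clear a1 a2 a3 a4.
    pose proof (nat_nonneg W k) as k0.
    assert (p1 : W ⊩ 0 <= b @ k * (rabsn (incln x' - incln (y @ k)) - c)) by (apply mul_nonneg;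
      ilra).
    assert (p2 : W ⊩ 0 <= (b @ k - i) * c) by (apply mul_nonneg; ilra).
    clear - p1 p2 ci g1. ilra.
  - assert (e : W ⊩ b @ k * rabsn (incln x' - incln (y @ k)) =
      0 * rabsn (incln x' - incln (y @ k))) by (irewrite hb; apply ieq_refl).
    clear - e hg. ilra.
Qed.

(** A single stage N > 1 / e decides. If w has not occurred by N, then 0 <= c_n <= g_N < e for n >=
    N; otherwise g_k = 1 for k >= N and c is constant from N on. *)
Lemma stage_infs_cauchy (W : world B) (u : nt B (Fun Nat E)) j w g b y c :
  W ⊩ (∀ x : Interval, j @ x = w → ⊥) ->
  W ⊩ (∀ k : Nat, stage u j w k (g @ k) (b @ k) (y @ k)) ->
  W ⊩ (∀ n : Nat, is_inf_upto g n (c @ n)) ->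
  W ⊩ (∀ e : Real, 0 < e → ∃ N : Nat, ∀ m : Nat, ∀ n : Nat,
        N ≼ m → N ≼ n → rabsn (c @ m - c @ n) < e).
Proof.
  intros apart st Hc. iintro e. iintro e0.
  idestruct (inverse W e e0) as [i [i0 ei]]. idestruct (archimedean W i) as [N iN].
  iexists N.
  assert (nonneg : W ⊩ (∀ n : Nat, 0 <= c @ n)).
  { iintro n. idestruct (all_e Hc n) as [_ approx]. iintro l.
    assert (p : W ⊩ 0 < - (c @ n)) by ilra. idestruct (imp_e (all_e approx _) p) as [k [_ hk]].
    idestruct (stage_bounds W u j w k (g @ k) (b @ k) (y @ k) (all_e st k)) as [g1 _]. ilra. }
  idestruct (all_e st N) as [[_ [hg _]]|[hw _]].
  - idestruct (stage_bounds W u j w N (g @ N) (b @ N) (y @ N) (all_e st N)) as [g1 _].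
    assert (small : W ⊩ (∀ n : Nat, N ≼ n → c @ n < e)).
    { iintro n. iintro Nn. idestruct (all_e Hc n) as [low _].
      pose proof (imp_e (all_e low N) Nn) as q. cbv beta in q. pose proof (ofnat_succ W N) as sN.
      assert (p : W ⊩ 0 < e * (ofnatn (succn N) - i)) by (apply lt_mul; ilra).
      assert (p' : W ⊩ 0 < ofnatn (succn N) * (e - g @ N)) by (clear - p ei hg; ilra).
      apply nat_mul_pos in p'. clear - p' q. ilra. }
    iintro m. iintro n. iintro Nm. iintro Nn.
    pose proof (imp_e (all_e small m) Nm) as sm. pose proof (imp_e (all_e small n) Nn) as sn.
    pose proof (all_e nonneg m) as zm. pose proof (all_e nonneg n) as zn. cbv beta in *.
    clear - sm sn zm zn. apply abs_lt; ilra.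
  - pose proof (ofnat_zero W) as z0.
    assert (one : W ⊩ (∀ k : Nat, N ≼ k → g @ k = 1)).
    (* A later stage cannot be of the first kind, since it would put the occurrence of w into the
       image of j. *)
    { iintro k. iintro Nk. idestruct (all_e st k) as [[hu _]|[_ [hg _]]]; [|exact hg].
      idestruct hw as [l [lN hl]]. assert (lk : W ⊩ l ≼ k) by ilra.
      idestruct (imp_e (all_e hu l) lk) as [x hx]. apply ex_falso.
      refine (imp_e (all_e apart x) (ieq_trans (ieq_sym hx) hl)). }
    idestruct (stage_zero W u j w (g @ zeron) (b @ zeron) (y @ zeron) (all_e st zeron)) as [g0 _].
    assert (le : W ⊩ (∀ m : Nat, ∀ n : Nat, N ≼ m → N ≼ n → c @ m <= c @ n)).
    { iintro m. iintro n. iintro Nm. iintro Nn. iintro l.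
      idestruct (all_e Hc m) as [low _]. idestruct (all_e Hc n) as [_ approx].
      assert (p : W ⊩ 0 < c @ m - c @ n) by ilra.
      idestruct (imp_e (all_e approx _) p) as [k [_ hk]].
      idestruct (nat_le_or_lt W k N) as [kN|kN].
      - assert (km : W ⊩ k ≼ m) by ilra. pose proof (imp_e (all_e low k) km) as q. cbv beta in q.
        clear - hk q. ilra.
      (* Beyond N, g_k = 1 = g_0, and g_0 already bounds c_m from above. *)
      - pose proof (ofnat_succ W N) as sN. assert (Nk : W ⊩ N ≼ k) by ilra.
        pose proof (imp_e (all_e one k) Nk) as q. pose proof (nat_nonneg W m) as m0.
        assert (zm : W ⊩ zeron ≼ m) by ilra. pose proof (imp_e (all_e low zeron) zm) as r.
        cbv beta in q, r. clear - hk q r g0. ilra. }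
    iintro m. iintro n. iintro Nm. iintro Nn.
    pose proof (imp_e (imp_e (all_e (all_e le m) n) Nm) Nn) as l1.
    pose proof (imp_e (imp_e (all_e (all_e le n) m) Nn) Nm) as l2. cbv beta in l1, l2.
    clear - l1 l2 e0. apply abs_lt; ilra.
Qed.

Lemma AS_of_POS (W : world B) (rho : nt B (Fun E (Fun E Real))) j w :
  W ⊩ den POS_sentence tt -> W ⊩ den (AS_formula E) (w, (j, (rho, tt))).
Proof.
  iunfold. intro POS.
  iintro [_ [m_refl _]]. iintro iso. iintro apart. iintro u. iintro U. iintro away.
  assert (jw : W ⊩ (∀ x : Interval, j @ x = w → ⊥)).
  { iintro x. iintro h. idestruct apart as [d [d0 hd]].
    pose proof (all_e hd x) as q. pose proof (all_e m_refl w) as r. cbv beta in q, r.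
    assert (e : W ⊩ rho @ w @ (j @ x) = rho @ w @ w) by (irewrite h; apply ieq_refl).
    clear - q r e d0. ilra. }
  idestruct (stages W u j w U) as [g st]. idestruct st as [b st]. idestruct st as [y st].
  idestruct (stage_zero W u j w (g @ zeron) (b @ zeron) (y @ zeron) (all_e st zeron)) as [g0 b0].
  assert (far : W ⊩ (∀ x : Interval, ∃ N : Nat, ∃ d : Real, 0 < d ∧
    ∀ x' : Interval, rabsn (incln x - incln x') < d → ∀ k : Nat, N ≼ k → 1 <= spike g b y x' k)).
  { iintro x. exact (spikes_far W rho j u w g b y x iso st (all_e away x)). }
  assert (bd : W ⊩ (∀ k : Nat, 0 <= b @ k ∧ b @ k <= ofnatn k)).
  { iintro k. idestruct (stage_bounds W u j w k (g @ k) (b @ k) (y @ k)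
      (all_e st k)) as [_ [b1 [b2 _]]].
    isplit; auto. }
  assert (self : forall (W : world B) x, W ⊩ rabsn (incln x - incln x) = 0).
  { intros W' x. assert (k : W' ⊩ rabsn (incln x - incln x) <= 0) by (apply abs_le; ilra).
    pose proof (abs_nonneg W' (incln x - incln x)). ilra. }
  (* The infimum at x is unique, so f comes from function existence and no choice over [0,1] is
     made. *)
  assert (F : W ⊩ (∃ f : Fun Interval Real, ∀ x : Interval, is_spike_inf g b y x (f @ x))).
  { refine (function_exists (abs5 (fun v x g b y =>
      (∀ k : Nat, #v <= #g @ #k + #b @ #k * rabs (incl #x - incl (#y @ #k))) ∧
      (∀ e : Real, 0 < #e → ∃ k : Nat,
         #g @ #k + #b @ #k * rabs (incl #x - incl (#y @ #k)) < #v + #e))%B)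
      (g, (b, (y, tt))) W _ _ _ _ _).
    - iok.
    - iunfold. iintro x. idestruct (all_e far x) as [N h]. idestruct h as [d [d0 h]].
      assert (xx : W ⊩ rabsn (incln x - incln x) < d) by (pose proof (self W x); ilra).
      idestruct (spike_inf_exists W g b y x N g0 b0 (imp_e (all_e h x) xx)) as [v [v1 v2]].
      pose proof (and_i v1 v2) as hv.
      iexists v. isplit; [exact hv|]. iintro v'. iintro [v'1 v'2].
      pose proof (and_i v'1 v'2) as hv'.
      apply eq_of_le;
        [exact (spike_inf_unique W g b y x _ _ hv' hv) | exact
          (spike_inf_unique W g b y x _ _ hv hv')]. }
  idestruct F as [f Hf].
  assert (pos : W ⊩ (∀ x : Interval, 0 < f @ x)).
  { iintro x. idestruct (all_e far x) as [N h]. idestruct h as [d [d0 h]].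
    assert (xx : W ⊩ rabsn (incln x - incln x) < d) by (pose proof (self W x); ilra).
    pose proof (imp_e (all_e h x) xx) as fx. cbv beta in fx.
    pose proof (nat_nonneg W N) as N0. pose proof (ofnat_succ W N) as sN.
    assert (p : W ⊩ 0 < ofnatn (succn N)) by ilra.
    (* With i = 1 / (N + 1), spikes up to N are at least g_k >= i, and the later ones are at least 1
       >= i. *)
    idestruct (inverse W _ p) as [i [i0 ie]].
    assert (low : W ⊩ i <= f @ x); [|clear - low i0; ilra].
    idestruct (all_e Hf x) as [_ approx]. iintro l. assert (q : W ⊩ 0 < i - f @ x) by ilra.
    idestruct (imp_e (all_e approx _) q) as [k hk].
    idestruct (nat_le_or_lt W k N) as [kN|kN].
    - idestruct (stage_bounds W u j w k (g @ k) (b @ k) (y @ k) (all_e st k)) as [g1 [b1 [_ gN]]].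
      pose proof (imp_e (all_e gN N) kN) as r. cbv beta in r.
      pose proof (abs_nonneg W (incln x - incln (y @ k))) as a.
      assert (ba : W ⊩ 0 <= b @ k * rabsn (incln x - incln (y @ k))) by (apply mul_nonneg; ilra).
      assert (s : W ⊩ 0 < i - g @ k) by (clear - hk ba; ilra).
      assert (s' : W ⊩ 0 < (i - g @ k) * ofnatn (succn N)) by (apply lt_mul; ilra).
      clear - s' r ie. ilra.
    - assert (Nk : W ⊩ N ≼ k) by ilra. pose proof (imp_e (all_e fx k) Nk) as r. cbv beta in r.
      assert (s : W ⊩ 0 <= i * ofnatn N) by (apply mul_nonneg; ilra).
      assert (e : W ⊩ ofnatn (succn N) * i = (ofnatn N + 1) * i) by (irewrite sN; apply ieq_refl).
      clear - hk r s e ie. ilra. }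
  assert (cont : W ⊩ (∀ x : Interval, ∀ e : Real, 0 < e → ∃ d : Real, 0 < d ∧
    ∀ x' : Interval, rabsn (incln x - incln x') < d → rabsn (f @ x - f @ x') < e)).
  { iintro x. iintro e. iintro e0. idestruct (all_e far x) as [N h]. idestruct h as [d [d0 h]].
    assert (xx : W ⊩ rabsn (incln x - incln x) < d) by (pose proof (self W x); ilra).
    pose proof (imp_e (all_e h x) xx) as fx. cbv beta in fx.
    pose proof (nat_nonneg W N) as N0. pose proof (ofnat_succ W N) as sN.
    assert (p : W ⊩ 0 < ofnatn (succn N)) by ilra.
    idestruct (inverse W _ p) as [i [i0 ie]].
    (* Within d of x the values of f differ by at most N |x - x'|; the radius e / (N + 1) also makes
       sense for N = 0. *)
    idestruct (min_pos W d (e * i) d0 (lt_mul W e i e0 i0)) as [d' [d'0 [d'd d'e]]].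
    iexists d'. isplit; [exact d'0|]. iintro x'. iintro near.
    assert (near' : W ⊩ rabsn (incln x - incln x') < d) by ilra.
    pose proof (imp_e (all_e h x') near') as fx'. cbv beta in fx'.
    pose proof (spike_inf_lipschitz W g b y N x x' _ _ bd g0 b0 fx' (all_e Hf x)
      (all_e Hf x')) as l1.
    pose proof (spike_inf_lipschitz W g b y N x' x _ _ bd g0 b0 fx (all_e Hf x')
      (all_e Hf x)) as l2.
    pose proof (abs_ge W (incln x - incln x')) as a1.
    pose proof (abs_ge_opp W (incln x - incln x')) as a2.
    assert (sym : W ⊩ rabsn (incln x' - incln x) <= rabsn (incln x - incln x')) by (apply abs_le;
      ilra).
    pose proof (abs_nonneg W (incln x - incln x')) as a0.
    assert (q1 : W ⊩ 0 < ofnatn (succn N) * (e * i - rabsn (incln x - incln x')))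
      by (apply lt_mul; ilra).
    assert (q2 : W ⊩ e * (ofnatn (succn N) * i) = e * 1) by (irewrite ie; apply ieq_refl).
    assert (q3 : W ⊩ ofnatn (succn N) * rabsn (incln x - incln x') =
      (ofnatn N + 1) * rabsn (incln x - incln x')) by (irewrite sN; apply ieq_refl).
    assert (q4 : W ⊩ 0 <= ofnatn N * (rabsn (incln x - incln x') - rabsn (incln x' - incln x)))
      by (apply mul_nonneg; ilra).
    clear - l1 l2 a0 q1 q2 q3 q4. apply abs_lt; ilra. }
  assert (C : W ⊩ (∃ c : Fun Nat Real, ∀ n : Nat, is_inf_upto g n (c @ n))).
  { refine (countable_choice (abs3 (fun v n g => (∀ k : Nat, #k ≼ #n → #v <= #g @ #k) ∧
      (∀ e : Real, 0 < #e → ∃ k : Nat, #k ≼ #n ∧ #g @ #k < #v + #e))%B) (g, tt) W _ _ _ _ _).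
    - iok.
    - iden. iintro n. exact (finite_inf W g n). }
  idestruct C as [c Hc].
  idestruct (complete W c (stage_infs_cauchy W u j w g b y c jw st Hc)) as [m lim].
  assert (at_center : W ⊩ (∀ k : Nat, f @ (y @ k) <= g @ k)).
  { iintro k. idestruct (all_e Hf (y @ k)%nt) as [low _]. pose proof (all_e low k) as q.
    cbv beta in q.
    pose proof (self W (y @ k)%nt) as z.
    assert (e : W ⊩ b @ k * rabsn (incln (y @ k) - incln (y @ k)) = b @ k * 0)
      by (irewrite z; apply ieq_refl).
    clear - q e. ilra. }
  assert (inf : W ⊩ (∀ x : Interval, m <= f @ x) ∧
    (∀ e : Real, 0 < e → ∃ x : Interval, f @ x < m + e)).
  { isplit.
    (* Were f(x) < m, with 2 e = m - f(x), some g_k would lie below m - e, and so would c_n for all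
       n >= k, although c_n tends to m. *)
    - iintro x. iintro l. assert (p : W ⊩ 0 < m - f @ x) by ilra.
      idestruct (half W _ p) as [e [e0 ee]].
      idestruct (all_e Hf x) as [_ approx]. idestruct (imp_e (all_e approx e) e0) as [k hk].
      idestruct (stage_bounds W u j w k (g @ k) (b @ k) (y @ k) (all_e st k)) as [_ [b1 _]].
      pose proof (abs_nonneg W (incln x - incln (y @ k))) as a.
      assert (ba : W ⊩ 0 <= b @ k * rabsn (incln x - incln (y @ k))) by (apply mul_nonneg; ilra).
      idestruct (imp_e (all_e lim e) e0) as [N hN].
      idestruct (nat_max W N k) as [n [Nn kn]].
      pose proof (imp_e (all_e hN n) Nn) as q. cbv beta in q.
      idestruct (all_e Hc n) as [low _]. pose proof (imp_e (all_e low k) kn) as r. cbv beta in r.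
      pose proof (abs_ge_opp W (c @ n - m)) as s. clear - hk ba q r s ee. ilra.
    - iintro e. iintro e0. idestruct (half W e e0) as [d [d0 de]].
      idestruct (imp_e (all_e lim d) d0) as [N hN].
      pose proof (imp_e (all_e hN N) le_refl) as q. cbv beta in q.
      idestruct (all_e Hc N) as [_ approx]. idestruct (imp_e (all_e approx d) d0) as [k [_ hk]].
      pose proof (abs_ge W (c @ N - m)) as s. pose proof (all_e at_center k) as r. cbv beta in r.
      iexists (y @ k)%nt. clear - hk q r s de. ilra. }
  assert (m0 : W ⊩ 0 < m).
  { exact (imp_e (all_e (imp_e (imp_e (all_e POS f) cont) pos) m) inf). }
  (* At stage n > 1 / m the first alternative would give m <= f(u_n) <= 1 / (n + 1) < m, so w has
     occurred by then. *)
  idestruct (inverse W m m0) as [i [i0 mi]]. idestruct (archimedean W i) as [n hn].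
  idestruct (all_e st n) as [[_ [hg _]]|[hw _]].
  - pose proof (all_e at_center n) as q. idestruct inf as [low _].
    pose proof (all_e low (y @ n)%nt) as r. cbv beta in q, r.
    pose proof (ofnat_succ W n) as sn. pose proof (nat_nonneg W n) as n0.
    assert (p1 : W ⊩ 0 <= (g @ n - m) * ofnatn (succn n)) by (apply mul_nonneg; ilra).
    assert (p2 : W ⊩ 0 < m * (ofnatn (succn n) - i)) by (apply lt_mul; ilra).
    apply ex_falso. clear - p1 p2 hg mi. ilra.
  - idestruct hw as [l [_ hl]]. iexists l. exact hl.
Qed.

End POSImpliesAS.

(** * From forcing to derivability *)

Definition top {G : ctx} : fm G := Imp Bot Bot.

(* Some inhabited sorts, such as [Interval], have no closed term; a variable is adjoined. *)
Lemma adjoin {G s} {p : fm G} :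
  proves G [] (Ex s top) -> proves (s :: G) [] (wk p) -> proves G [] p.
Proof.
  intros h k. apply (pr_ex_elim _ _ _ _ _ h), (proves_incl k). intros x [].
Qed.

Lemma inhabited_term {G s} (t : tm G s) : proves G [] (Ex s top).
Proof. apply (pr_ex_intro _ _ _ _ t), pr_imp_intro, pr_hyp; left; reflexivity. Qed.

Lemma inhabited_interval {G} : proves G [] (Ex Interval top).
Proof.
  assert (le0 : forall H, proves G H (0 <= 0)%B).
  { intro H. apply pr_imp_intro. eapply pr_imp_elim; [eapply pr_imp_elim|];
      [apply pr_axiom, ax_rlt_asym | |]; apply pr_hyp; left; reflexivity. }
  assert (le1 : forall H, proves G H (0 <= 1)%B).
  { intro H. apply pr_imp_intro. eapply pr_imp_elim; [eapply pr_imp_elim|];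
      [apply pr_axiom, ax_rlt_asym | |apply pr_axiom, ax_rlt_zero_one].
    apply pr_hyp; left; reflexivity. }
  eapply pr_ex_elim.
  - eapply pr_imp_elim; [eapply pr_imp_elim|];
      [apply pr_axiom, (ax_incl_surj G 0%B) | apply le0 | apply le1].
  - apply (pr_ex_intro _ _ _ _ (Var vz)), pr_imp_intro, pr_hyp; left; reflexivity.
Qed.

(** A constant function, obtained from its graph; it makes a function sort inhabited as soon as its
    value sort is. *)
Lemma inhabited_fun {G a b} (v : var G b) : proves G [] (Ex (Fun a b) top).
Proof.
  eapply pr_ex_elim.
  - eapply pr_imp_elim; [apply pr_axiom, (ax_fun_ex G a b (Eq (Var vz) (Var (vs (vs v)))))|].
    apply pr_all_intro, (pr_ex_intro _ _ _ _ (Var (vs v))), pr_and_intro.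
    + apply pr_eq_refl.
    + apply pr_all_intro, pr_imp_intro, pr_hyp; left; reflexivity.
  - apply (pr_ex_intro _ _ _ _ (Var vz)), pr_imp_intro, pr_hyp; left; reflexivity.
Qed.

Lemma proves_closed {G p} H : proves G [] p -> proves G H p.
Proof. intro h; exact (proves_incl h H (List.incl_nil_l H)). Qed.

Ltac find_var := solve [exact vz | refine (vs _); find_var].
Tactic Notation "adjoin_sequence" constr(b) :=
  refine (adjoin (inhabited_fun (a := Nat) (b := b) _) _); [find_var|].
Ltac find_inh := refine (inhabits (Var _)); find_var.

Lemma POS_derives_AS : derivable_from (POS_p unit_interval) (AS_L unit_interval).
Proof.
  intros q [E ->]. exists [POS_sentence]. split; [intros p [<-|[]]; reflexivity|].
  change (proves [] [POS_sentence] (AS_sentence E)).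
  do 3 apply pr_all_intro. cbn [map].
  eapply pr_imp_elim; [|apply pr_hyp; left; reflexivity].
  apply proves_closed.
  apply (adjoin inhabited_interval).
  apply (adjoin (inhabited_term (Cst c_rzero))).
  apply (adjoin (inhabited_term (tpair (Var vz) (tpair (Var vz) (Var (vs vz)))))).
  apply (adjoin (inhabited_term (tpair zero (Var vz)))).
  apply (adjoin (inhabited_term (tpair zero (Var (vs (vs vz)))))).
  adjoin_sequence E.
  adjoin_sequence Interval.
  adjoin_sequence triple.
  adjoin_sequence (Prod Nat triple).
  adjoin_sequence (Prod Nat Real).
  (* After weakening by the adjoined variables the goal becomes a substitution instance of a formula
     in w, j and rho, as [adequacy] expects. *)
  unfold wk; rewrite !fm_ren_sub, !fm_sub_sub.
  match goal with |- proves ?B _ _ =>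
    assert (i1 : Inh B E) by find_inh;
    assert (i2 : Inh B Interval) by find_inh;
    assert (i3 : Inh B (Fun Nat E)) by find_inh;
    assert (i4 : Inh B (Fun Nat Interval)) by find_inh;
    assert (i5 : Inh B (Fun Nat triple)) by find_inh;
    assert (i6 : Inh B (Fun Nat (Prod Nat triple))) by find_inh;
    assert (i7 : Inh B (Fun Nat (Prod Nat Real))) by find_inh
  end.
  apply adequacy.
  - iok.
  - intros [w [j [rho []]]] W _ POS. exact (AS_of_POS W rho j w POS).
Qed.

Lemma AS_derives_POS : derivable_from (AS_L unit_interval) (POS_p unit_interval).
Proof.
  (* The real line contains a one-point extension of [0,1], so the instance for [Real] suffices. *)
  intros q ->. exists [AS_sentence Real]. split; [intros p [<-|[]]; apply AS_sentence_spec|].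
  eapply pr_imp_elim; [|apply pr_hyp; left; reflexivity].
  apply proves_closed.
  apply (adjoin inhabited_interval).
  apply (adjoin (inhabited_term (tpair zero (Cst c_rzero)))).
  adjoin_sequence (Prod Nat Real).
  unfold wk; rewrite !fm_ren_sub, !fm_sub_sub.
  match goal with |- proves ?B _ _ =>
    assert (i1 : Inh B Interval) by find_inh;
    assert (i2 : Inh B (Fun Nat (Prod Nat Real))) by find_inh
  end.
  assert (Inh [Fun Nat (Prod Nat Real); Prod Nat Real;
    Interval] (Fun Real (Fun Real Real))) by exact (inhabits (Cst c_radd)).
  apply adequacy.
  - iok.
  - intros [] W _ AS. exact (POS_of_AS W AS).
Qed.

Theorem proposition5p1 :
  equivalent_over_BISH (POS_p unit_interval) (AS_L unit_interval).
Proof. exact (conj POS_derives_AS AS_derives_POS). Qed.
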